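(* The flow given by the Fermionic Mehler semigroup on $\mathfrak{P}_+$ is the same as the gradient flow of the relative entropy $S(\rho)=\tau[\rho\log\rho]$ on the Riemannian manifold $(\mathfrak{P}_+,g)$. That is, the continuously differentiable curves $\rho:[0,\infty)\to\mathfrak{P}_+$ satisfying $$\frac{\mathrm d}{\mathrm dt}\rho(t)+\operatorname{div}\big[(\Gamma(\rho(t)),\rho(t))\#\,(-\operatorname{grad}_{\rho(t)}S)\big]=0$$ are exactly the curves $\rho(t)=\mathcal{P}_t\rho_0$ with $\rho_0\in\mathfrak{P}_+$.
   Context: Clifford algebra. Fix $n\ge 1$. On $\mathcal H=(\mathbb C^2)^{\otimes n}$ let $Q=\begin{pmatrix}0&1\\1&0\end{pmatrix}$, $U_0=\begin{pmatrix}1&0\\0&-1\end{pmatrix}$, and let $Q_j=U_0^{\otimes(j-1)}\otimes Q\otimes I^{\otimes(n-j)}$, so $Q_iQ_j+Q_jQ_i=2\delta_{ij}I$. Let $\mathfrak{C}$ be the complex algebra generated by $Q_1,\dots,Q_n$; it has basis $Q^{\alpha}=Q_1^{\alpha_1}\cdots Q_n^{\alpha_n}$, $\alpha\in\{0,1\}^n$, $|\alpha|=\sum_j\alpha_j$. Let $\tau=2^{-n}\operatorname{Tr}$ (so $\tau(Q^\alpha)=\delta_{0,|\alpha|}$) and $\langle A,B\rangle_{L^2(\tau)}=\tau(A^*B)$. Calculus. $\Gamma$ is the linear map with $\Gamma(Q^\alpha)=(-1)^{|\alpha|}Q^\alpha$ (a $*$-automorphism). $\nabla_i(A)=\frac12(Q_iA-\Gamma(A)Q_i)$,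 $\nabla A=(\nabla_1A,\dots,\nabla_nA)\in\mathfrak{C}^n$; the $L^2(\tau)$-adjoint of $\nabla_i$ is $\nabla_i^*(A)=\frac12(Q_iA+\Gamma(A)Q_i)$, and $\operatorname{div}(\mathbf A)=-\sum_i\nabla_i^*(A_i)$. The number operator is $\mathcal N=-\operatorname{div}\nabla=\sum_i\nabla_i^*\nabla_i$ (so $\mathcal NQ^\alpha=|\alpha|Q^\alpha$), and the Fermionic Mehler semigroup is $\mathcal P_t=e^{-t\mathcal N}$, $t\ge0$ (it is known to map $\mathfrak P$ and $\mathfrak P_+$ into themselves). Densities. $\mathfrak{P}$ is the set of $\rho\in\mathfrak C$ with $\rho\ge0$ and $\tau(\rho)=1$; $\mathfrak P_+$ is the subset of strictly positive (invertible) ones. For $\rho\in\mathfrak{P}_+$, $(\Gamma(\rho),\rho)\#C=\int_0^1\Gamma(\rho)^{1-s}C\rho^s\,\mathrm ds$, applied componentwise on $\mathfrak C^n$. Metric. For $\rho\in\mathfrak P_+$ and a continuously differentiable curve $\rho(\cdot)$ in $\mathfrak{P}_+$ with $\rho(0)=\rho$ there is a unique gradient $\nabla U$ with $\dot\rho(0)+\operatorname{div}[(\Gamma(\rho),\rho)\#\nabla U]=0$, and $U$ may be taken self-adjoint; the tangent vector $\dot\rho(0)$ is identified with $\nabla U$, so the tangent space $T_\rho$ is identified with $\{\nabla U: U=U^*\in\mathfrak{C}\}$. The Riemannian metric is $g_\rho(\nabla U,\nabla V)=\sum_i\tau[(\nabla_i U)^*(\Gamma(\rho),\rho)\#\nabla_i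 V]$. For a smooth real function $F$ on $\mathfrak P_+$, $\operatorname{grad}_\rho F\in T_\rho$ is the element with $\frac{\mathrm d}{\mathrm dt}F(\rho(t))|_{t=0}=g_\rho(\operatorname{grad}_\rho F,\dot\rho(0))$ for all smooth curves in $\mathfrak{P}_+$ with $\rho(0)=\rho$ (with $\dot\rho(0)$ identified with the unique gradient vector field $\nabla U$, $U=U^*\in\mathfrak{C}$, satisfying $\dot\rho(0)+\operatorname{div}[(\Gamma(\rho),\rho)\#\nabla U]=0$). *)

(* Defs.v *)
From HB Require Import structures.
From mathcomp Require Import all_boot all_order all_algebra spectral sesquilinear.
From mathcomp Require Import complex.
From mathcomp Require mxtens.
From mathcomp Require Import ring.
From mathcomp Require Import all_classical all_reals all_analysis.

Set Implicit Arguments.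
Unset Strict Implicit.
Unset Printing Implicit Defensive.

Import Order.TTheory GRing.Theory Num.Theory.
Import numFieldNormedType.Exports.

Local Open Scope ring_scope.
Local Open Scope classical_set_scope.
Local Open Scope complex_scope.
Local Open Scope sesquilinear_scope.

Section EntrywiseCalculus.
Variables (R : realType) (m : nat).
Implicit Types (c D : R -> 'M[R[i]]_m) (M : 'M[R[i]]_m).

(* [mxlift L F] applies the real-valued limiting operation [L] (integral,
   derivative, sum of a series) to the real and to the imaginary part of every
   entry of the matrix-valued function [F]. *)
Definition mxlift (T : Type) (L : (T -> R) -> R) (F : T -> 'M[R[i]]_m) :
    'M[R[i]]_m :=
  \matrix_(i, j) (L (fun x => complex.Re (F x i j))
                  +i* L (fun x => complex.Im (F x i j))).

Definition mxintegral01 : (R -> 'M[R[i]]_m) -> 'M[R[i]]_m :=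
  mxlift (fun f => \int[@lebesgue_measure R]_(s in `[0, 1]) f s).

Definition mxderive c (t : R) : 'M[R[i]]_m := mxlift (fun f => f^`() t) c.

Definition mxseries : (nat -> 'M[R[i]]_m) -> 'M[R[i]]_m :=
  mxlift (fun u => limn (series u)).

Definition smooth_on (e : R) (f : R -> R) : Prop :=
  forall (k : nat) (t : R), `|t| < e -> derivable f^`(k) t 1.

Definition mxsmooth_on (e : R) c : Prop :=
  forall i j, smooth_on e (fun t => complex.Re (c t i j)) /\
              smooth_on e (fun t => complex.Im (c t i j)).

(* Differentiability of a function on [0, +oo[; at 0 this is the one-sided
   derivative, and the values at negative times play no role. *)
Definition is_halfline_derive (f : R -> R) (t l : R) : Prop :=
  (f s - f t) / (s - t) @[s --> within [set s | 0 <= s] t^'] --> l.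

Definition mxis_halfline_derive c (t : R) M : Prop :=
  forall i j,
    is_halfline_derive (fun s => complex.Re (c s i j)) t (complex.Re (M i j)) /\
    is_halfline_derive (fun s => complex.Im (c s i j)) t (complex.Im (M i j)).

Definition mxcontinuous_halfline D : Prop :=
  forall i j, {within `[0, +oo[, continuous (fun t => complex.Re (D t i j))} /\
              {within `[0, +oo[, continuous (fun t => complex.Im (D t i j))}.

Definition C1_halfline c D : Prop :=
  (forall t, 0 <= t -> mxis_halfline_derive c t (D t)) /\
  mxcontinuous_halfline D.

End EntrywiseCalculus.

Section FunctionalCalculus.
Variables (R : realType) (m : nat).
Implicit Types (A : 'M[R[i]]_m) (f : R -> R).

Definition mxpos A : Prop :=
  A \is hermsymmx /\ forall v : 'cV[R[i]]_m, 0 <= (v^t* *m A *m v) 0 0.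

(* f(A) for Hermitian A = P^-1 diag(d) P with P unitary and d real *)
Definition mxfun f A : 'M[R[i]]_m :=
  invmx (spectralmx A)
    *m diag_mx (map_mx (fun z => (f (complex.Re z))%:C) (spectral_diag A))
    *m spectralmx A.

Definition mxlog A : 'M[R[i]]_m := mxfun (@ln R) A.

Definition mxpowR A (s : R) : 'M[R[i]]_m := mxfun (fun x => x `^ s) A.

End FunctionalCalculus.

Section Clifford.
Variables (R : realType) (n : nat).
Local Notation C := R[i].

Fixpoint tensor_rec (f : nat -> 'M[C]_2) (k : nat) : 'M[C]_(2 ^ k.+1) :=
  if k is k'.+1 then mxtens.tensmx (f 0%N) (tensor_rec (f \o succn) k')
  else f 0%N.

(* f 0 (x) f 1 (x) ... (x) f (k - 1) acting on (C^2)^{(x) k} *)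
Definition tensor (f : nat -> 'M[C]_2) (k : nat) : 'M[C]_(2 ^ k) :=
  if k is k'.+1 return 'M[C]_(2 ^ k) then tensor_rec f k' else 1%:M.

Definition pauliQ : 'M[C]_2 := \matrix_(i, j) (i != j)%:R.

Definition pauliU : 'M[C]_2 :=
  \matrix_(i, j) if i == j then (-1) ^+ i else 0.

(* indices are shifted: Q_1, ..., Q_n are [Qgen 0], ..., [Qgen (n - 1)] *)
Definition Qgen (j : 'I_n) : 'M[C]_(2 ^ n) :=
  tensor (fun k => if (k < j)%N then pauliU
                   else if k == j then pauliQ else 1%:M) n.

(* multi-indices in {0,1}^n are subsets of 'I_n; the product is taken in
   increasing order of the indices *)
Definition Qmon (a : {set 'I_n}) : 'M[C]_(2 ^ n) :=
  \prod_(j < n | j \in a) Qgen j.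

Inductive clifford : 'M[C]_(2 ^ n) -> Prop :=
| clifford_one : clifford 1%:M
| clifford_gen (j : 'I_n) : clifford (Qgen j)
| clifford_scale (z : C) A : clifford A -> clifford (z *: A)
| clifford_add A B : clifford A -> clifford B -> clifford (A + B)
| clifford_mul A B : clifford A -> clifford B -> clifford (A *m B).

Definition tau (A : 'M[C]_(2 ^ n)) : C := (2 ^+ n)^-1 * \tr A.

(* the linear map Q^a |-> (-1)^|a| Q^a, written in the L^2(tau)-orthonormal
   basis (Q^a); see [Gamma_is_linear] and [GammaQ] *)
Definition Gamma (A : 'M[C]_(2 ^ n)) : 'M[C]_(2 ^ n) :=
  \sum_(a : {set 'I_n}) ((-1) ^+ #|a| * tau ((Qmon a)^t* *m A)) *: Qmon a.

Definition nabla (A : 'M[C]_(2 ^ n)) (i : 'I_n) : 'M[C]_(2 ^ n) :=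
  2^-1 *: (Qgen i *m A - Gamma A *m Qgen i).

Definition nabla_adj (i : 'I_n) (A : 'M[C]_(2 ^ n)) : 'M[C]_(2 ^ n) :=
  2^-1 *: (Qgen i *m A + Gamma A *m Qgen i).

Definition cdiv (X : 'I_n -> 'M[C]_(2 ^ n)) : 'M[C]_(2 ^ n) :=
  - \sum_(i < n) nabla_adj i (X i).

Definition numop (A : 'M[C]_(2 ^ n)) : 'M[C]_(2 ^ n) := - cdiv (nabla A).

(* e^{-tN} A, as the exponential series of the operator -tN *)
Definition mehler (t : R) (A : 'M[C]_(2 ^ n)) : 'M[C]_(2 ^ n) :=
  mxseries (fun k => ((- t) ^+ k / k`!%:R)%:C *: iter k numop A).

Definition density (rho : 'M[C]_(2 ^ n)) : Prop :=
  [/\ clifford rho, mxpos rho & tau rho = 1].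

Definition pdensity (rho : 'M[C]_(2 ^ n)) : Prop :=
  density rho /\ rho \in unitmx.

Definition sharp (rho A : 'M[C]_(2 ^ n)) : 'M[C]_(2 ^ n) :=
  mxintegral01 (fun s => mxpowR (Gamma rho) (1 - s) *m A *m mxpowR rho s).

Definition vsharp (rho : 'M[C]_(2 ^ n)) (X : 'I_n -> 'M[C]_(2 ^ n)) :
  'I_n -> 'M[C]_(2 ^ n) := fun i => sharp rho (X i).

Definition tangent (X : 'I_n -> 'M[C]_(2 ^ n)) : Prop :=
  exists U, [/\ clifford U, U^t* = U & X = nabla U].

Definition metric (rho : 'M[C]_(2 ^ n)) (X Y : 'I_n -> 'M[C]_(2 ^ n)) : C :=
  \sum_(i < n) tau ((X i)^t* *m vsharp rho Y i).

(* G = grad_rho F *)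
Definition is_gradient (F : 'M[C]_(2 ^ n) -> R) (rho : 'M[C]_(2 ^ n))
    (G : 'I_n -> 'M[C]_(2 ^ n)) : Prop :=
  tangent G /\
  forall (e : R) (c : R -> 'M[C]_(2 ^ n)),
    0 < e -> (forall t, `|t| < e -> pdensity (c t)) -> mxsmooth_on e c ->
    c 0 = rho ->
  forall X, tangent X -> mxderive c 0 + cdiv (vsharp rho X) = 0 ->
    derivable (fun t => F (c t)) 0 1 /\
    (derive1 (fun t => F (c t)) 0)%:C = metric rho G X.

(* tau(rho log rho) is real for rho in [pdensity] *)
Definition entropy (rho : 'M[C]_(2 ^ n)) : R :=
  complex.Re (tau (rho *m mxlog rho)).

(* C^1 curves [0, +oo[ -> P_+ solving rho' + div (rho # (- grad S)) = 0 *)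
Definition entropy_gradient_flow (rho : R -> 'M[C]_(2 ^ n)) : Prop :=
  (forall t, 0 <= t -> pdensity (rho t)) /\
  exists2 D : R -> 'M[C]_(2 ^ n), C1_halfline rho D &
    forall t, 0 <= t -> exists2 G, is_gradient entropy (rho t) G &
      D t + cdiv (vsharp (rho t) (fun i => - G i)) = 0.

End Clifford.

Section TensorLemmas.
Variable R : realType.
Implicit Types (f g : nat -> 'M[R[i]]_2).

Let tensorSS f k :
  tensor f k.+2 = mxtens.tensmx (f 0%N) (tensor (f \o succn) k.+1).
Proof. by []. Qed.

Let tensor_1 k : tensor (fun=> 1%:M : 'M[R[i]]_2) k = 1%:M.
Proof.
case: k => // k; elim: k => // k IH.
rewrite tensorSS [X in mxtens.tensmx _ X]IH.
apply/matrixP => a b; rewrite !mxE -natrM mulnb.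
by rewrite -(can_eq (@mxtens.mxtens_unindexK 2 (2 ^ k.+1)%N)).
Qed.

Let tensor_mul f g k :
  tensor f k *m tensor g k = tensor (fun i => f i *m g i) k.
Proof.
case: k => [|k]; first by rewrite /= mulmx1.
elim: k f g => // k IH f g.
by rewrite !tensorSS mxtens.tensmx_mul IH.
Qed.

Let tensor_adj f k : (tensor f k)^t* = tensor (fun i => (f i)^t*) k.
Proof.
case: k => [|k]; first by rewrite /= trmx1 map_mx1.
elim: k f => // k IH f.
by rewrite !tensorSS mxtens.trmx_tens mxtens.map_mxT IH.
Qed.

Let mxtrace_tensor f k : \tr (tensor f k) = \prod_(i < k) \tr (f i).
Proof.
case: k => [|k]; first by rewrite big_ord0 mxtrace1.
elim: k f => [|k IH] f; first by rewrite big_ord1.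
rewrite tensorSS big_ord_recl.
rewrite (_ : \prod_(i < k.+1) _ = \tr (tensor (f \o succn) k.+1));
  last by rewrite IH.
rewrite /mxtrace mxtens.mulr_sum; apply: eq_bigr => i _.
by rewrite mxE.
Qed.

Variable n : nat.

Let q (j k : nat) : 'M[R[i]]_2 :=
  if (k < j)%N then pauliU R else if k == j then pauliQ R else 1%:M.

Let qmon (a : {set 'I_n}) (k : nat) := \prod_(j < n | j \in a) q j k.

Let QmonE (a : {set 'I_n}) : Qmon R a = tensor (qmon a) n.
Proof.
rewrite /Qmon.
have -> : qmon a =
    \big[(fun f g i => f i * g i)/(fun=> 1)]_(j < n | j \in a) q j.
  apply/funext => k; rewrite /qmon.
  by apply: (big_rec2 (fun x y => x = y k)) => // j x y _ ->.
apply: (big_rec2 (fun x y => x = tensor y n)) => [|j x y _ ->].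
  by rewrite tensor_1.
exact: tensor_mul.
Qed.

Let par (b : bool) (A : 'M[R[i]]_2) :=
  forall i j : 'I_2, (i != j) != b -> A i j = 0.

Let parM b b' A B : par b A -> par b' B -> par (b (+) b') (A *m B).
Proof.
move=> pA pB i j hij; rewrite mxE big1 // => k _.
have [hik|hik] := eqVneq (i != k) b; last by rewrite pA // mul0r.
rewrite pB ?mulr0 //; apply: contra hij => /eqP <-; rewrite -hik.
by case: i {hik} => [[|[|//]] ?]; case: j => [[|[|//]] ?];
   case: k => [[|[|//]] ?].
Qed.

Let par_adj b A : par b A -> par b (A^t*).
Proof.
move=> pA i j hij; rewrite !mxE pA; first exact: conjC0.
by rewrite (eq_sym j).
Qed.

Let par_q (j k : nat) : par (j == k) (q j k).
Proof.
rewrite /q; case: ltngtP => _ i i'; rewrite mxE;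
  by case: (eqVneq i i').
Qed.

Let par_qmon (a : {set 'I_n}) (k : 'I_n) : par (k \in a) (qmon a k).
Proof.
have -> : (k \in a) = \big[addb/false]_(j < n | j \in a) (j == k).
  have [ka|ka] := boolP (k \in a).
    by rewrite (bigD1 k) //= eqxx big1 ?addbF // => j /andP[_ /negbTE].
  by rewrite big1 // => j ja; apply/negP => /eqP jk; rewrite -jk ja in ka.
apply: (big_rec2 (fun b A => par b A)) => [|j b A _ pA].
  by move=> i j; rewrite mxE; case: (eqVneq i j).
by apply: parM => //; apply: par_q.
Qed.

Let q_unitary (j k : nat) : (q j k)^t* *m q j k = 1%:M.
Proof.
rewrite /q; case: ltngtP => _; apply/matrixP => a b;
  rewrite !mxE !big_ord_recl big_ord0 !mxE;
  case: a => [[|[|//]] ?]; case: b => [[|[|//]] ?];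
  rewrite /= ?(expr0, expr1, rmorph0, rmorph1, rmorphN1, mulr0, mul0r, mulr1,
    addr0, add0r) ?mulrNN ?mulr1 //.
Qed.

Let qmon_unitary (a : {set 'I_n}) (k : nat) :
  (qmon a k)^t* *m qmon a k = 1%:M.
Proof.
apply: (big_ind (fun A : 'M[R[i]]_2 => A^t* *m A = 1%:M)) => [|A B hA hB|j _].
- by rewrite trmx1 map_mx1 mulmx1.
- by rewrite trmx_mul map_mxM mulmxA -(mulmxA _ _ A) hA mulmx1 hB.
- exact: q_unitary.
Qed.

Lemma tau_Qmon (a b : {set 'I_n}) :
  tau ((Qmon R a)^t* *m Qmon R b) = (a == b)%:R.
Proof.
rewrite /tau !QmonE tensor_adj tensor_mul mxtrace_tensor.
have [<-|ab] := eqVneq a b.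
  under eq_bigr do rewrite qmon_unitary mxtrace1.
  by rewrite prodr_const card_ord mulVf // expf_eq0 pnatr_eq0 andbF.
have [k hk] : exists k, (k \in a) != (k \in b).
  by apply/existsP; apply: contraR ab; rewrite negb_exists => /forallP h;
     apply/eqP/setP => k; have := h k; rewrite negbK => /eqP.
rewrite (bigD1 k) //= [\tr _]big1 ?mul0r ?mulr0 // => i _.
have := parM (par_adj (@par_qmon a k)) (@par_qmon b k); apply.
by rewrite eqxx; case: (_ \in a) hk; case: (_ \in b).
Qed.

Lemma Gamma_is_linear : linear (@Gamma R n).
Proof.
move=> z A B; rewrite /Gamma scaler_sumr -big_split; apply: eq_bigr => a _ /=.
rewrite scalerA -scalerDl; congr (_ *: _).
by rewrite mulmxDr -scalemxAr /tau mxtraceD mxtraceZ; ring.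
Qed.

Lemma GammaQ (a : {set 'I_n}) : Gamma (Qmon R a) = (-1) ^+ #|a| *: Qmon R a.
Proof.
rewrite /Gamma (bigD1 a) //= tau_Qmon eqxx mulr1 big1 ?addr0 // => b ba.
by rewrite tau_Qmon (negbTE ba) mulr0 scale0r.
Qed.

End TensorLemmas.

(* Main.v *)
Require Import Defs.
From mathcomp Require Import all_boot all_order all_algebra.
From mathcomp Require Import spectral sesquilinear.
From mathcomp Require Import complex.
From mathcomp Require mxtens.
From mathcomp Require Import ring lra.
From mathcomp Require Import all_classical all_reals all_analysis.
Import Order.TTheory GRing.Theory Num.Theory.
Local Open Scope ring_scope.
Local Open Scope complex_scope.

(** Both sides of the equivalence are the linear equation rho' = - N rho in
    disguise.

    The gradient of the entropy at rho is nabla (log rho).  Indeed, if c is a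
    curve through rho with velocity H = - div (rho # X), Klein's inequality
    squeezes S(c(t)) - tau (c(t) log rho) between 0 and a constant times
    tau ((c(t) - rho)^2), which is quadratically small, so
    dS/dt = tau (log rho H); and the duality between nabla and its adjoint
    turns this number into g_rho (nabla log rho, X) ([entropy_gradient]).  The
    gradient is unique because the metric is positive definite on the tangent
    space and the affine curve rho + t H realizes any given tangent vector
    ([gradient_unique]).

    The weight # is chosen so that a noncommutative chain rule holds:
    rho # nabla (log rho) = nabla rho ([sharp_commutator_log]).  In a spectral
    basis of rho, the operation # multiplies the (x, y) block by the
    logarithmic mean of x and y, while the twisted commutator with log rho
    multiplies it by ln y - ln x; the product of the two factors is y - x.
    Therefore the gradient flow equation reads rho' = div nabla rho = - N rho
    ([entropy_flux]).

    In the basis of monomials Q^a the operator N is diagonal with eigenvalue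
    |a|, so a solution on the half-line has coefficients e^{-t|a|} c_a and is
    P_t rho(0) ([gradient_flow_mehler]).  Conversely P_t rho_0 solves the
    equation, and it remains in P_+: P_t is the product over i of the maps
    (1 + e^{-t})/2 id + (1 - e^{-t})/2 R_i, where R_i, the automorphism that
    changes the sign of Q_i alone, is conjugation by the unitary Q_i V with
    V = U_0 (x) ... (x) U_0 ([mehler_mixing], [posdef_mehler]). *)

(** * Tensor products of 2 x 2 matrices *)
Section Tensors.
Set Implicit Arguments.
Unset Strict Implicit.
Unset Printing Implicit Defensive.
Local Open Scope sesquilinear_scope.
Variable R : realType.
Local Notation C := R[i].
Implicit Types (f g : nat -> 'M[C]_2).

Lemma tensorSS f k :
  tensor f k.+2 = mxtens.tensmx (f 0%N) (tensor (f \o succn) k.+1).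
Proof. by []. Qed.

Lemma tensor_mul f g k :
  tensor f k *m tensor g k = tensor (fun i => f i *m g i) k.
Proof.
case: k => [|k]; first by rewrite /= mulmx1.
elim: k f g => // k IH f g.
by rewrite !tensorSS mxtens.tensmx_mul IH.
Qed.

Lemma tensor_adj f k : (tensor f k)^t* = tensor (fun i => (f i)^t*) k.
Proof.
case: k => [|k]; first by rewrite /= trmx1 map_mx1.
elim: k f => // k IH f.
by rewrite !tensorSS mxtens.trmx_tens mxtens.map_mxT IH.
Qed.

(** Turns commutation relations of tensor products into a count of the factors
    that anticommute. *)
Lemma tensor_scale (z : nat -> C) f k :
  tensor (fun i => z i *: f i) k = (\prod_(i < k) z i) *: tensor f k.
Proof.
case: k => [|k]; first by rewrite big_ord0 scale1r.
elim: k z f => [|k IH] z f; first by rewrite big_ord1.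
rewrite !tensorSS [X in mxtens.tensmx _ X](IH (z \o succn) (f \o succn)).
by rewrite [in RHS]big_ord_recl; apply/matrixP => i j; rewrite !mxE mulrACA.
Qed.

Lemma tensor1 k : tensor (fun=> 1%:M : 'M[C]_2) k = 1%:M.
Proof.
case: k => // k; elim: k => // k IH.
rewrite tensorSS [X in mxtens.tensmx _ X]IH.
apply/matrixP => a b; rewrite !mxE -natrM mulnb.
by rewrite -(can_eq (@mxtens.mxtens_unindexK 2 (2 ^ k.+1)%N)).
Qed.

Ltac mx2 := apply/matrixP => -[[|[|//]] ?] -[[|[|//]] ?];
  rewrite !mxE ?big_ord_recl ?big_ord0 ?mxE
    /= ?(expr0, expr1, rmorph0, rmorph1, rmorphN1, mulr0, mul0r, mulr1,
    addr0, add0r, mulN1r, mulrN1, opprK, oppr0) //.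

Lemma pauliU_sqr : pauliU R *m pauliU R = 1%:M. Proof. mx2. Qed.
Lemma pauliQ_sqr : pauliQ R *m pauliQ R = 1%:M. Proof. mx2. Qed.
Lemma pauliUQ : pauliU R *m pauliQ R = - (pauliQ R *m pauliU R).
Proof. mx2. Qed.
Lemma pauliU_adj : (pauliU R)^t* = pauliU R. Proof. mx2. Qed.
Lemma pauliQ_adj : (pauliQ R)^t* = pauliQ R. Proof. mx2. Qed.

End Tensors.

(** * The Clifford algebra and its grading *)
Section CliffordAlgebra.
Set Implicit Arguments.
Unset Strict Implicit.
Unset Printing Implicit Defensive.
Local Open Scope sesquilinear_scope.
Variables (R : realType) (n : nat).
Local Notation C := R[i].
Local Notation M := 'M[C]_(2 ^ n).
Local Notation Q := (@Qgen R n).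
Implicit Types (A B : M) (i j : 'I_n) (a b : {set 'I_n}).

(** V anticommutes with every generator, so that conjugation by it implements
    the grading automorphism. *)
Definition parity : M := tensor (fun=> pauliU R) n.
Local Notation V := parity.

Lemma parity_sqr : V *m V = 1%:M.
Proof. by rewrite tensor_mul pauliU_sqr tensor1. Qed.

Lemma parity_adj : V^t* = V.
Proof. by rewrite tensor_adj pauliU_adj. Qed.

Lemma Qgen_sqr j : Q j *m Q j = 1%:M.
Proof.
rewrite tensor_mul -[RHS]tensor1; congr (tensor _ n); apply/funext => k.
by case: ifP => _; [exact: pauliU_sqr|case: ifP => _; rewrite ?pauliQ_sqr ?mulmx1].
Qed.

Lemma Qgen_adj j : (Q j)^t* = Q j.
Proof.
rewrite tensor_adj; congr (tensor _ n); apply/funext => k.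
case: ifP => _; first exact: pauliU_adj.
by case: ifP => _; [exact: pauliQ_adj|rewrite trmx1 map_mx1].
Qed.

Lemma prod_sign_at j :
  \prod_(k < n) (if (k : nat) == j then -1 else 1 : C) = -1.
Proof.
rewrite (bigD1 j) //= eqxx big1 ?mulr1 // => k kj.
by rewrite ifF //; apply/negbTE.
Qed.

Lemma parityQ j : V *m Q j = - (Q j *m V).
Proof.
rewrite !tensor_mul -scaleN1r -(prod_sign_at j).
rewrite -(tensor_scale (fun k => if k == j then -1 else 1)).
congr (tensor _ n); apply/funext => k.
case: ltngtP => _; rewrite ?scale1r //; last by rewrite scaleN1r pauliUQ.
by rewrite mulmx1 mul1mx.
Qed.

Lemma QgenC_lt i j : (i < j)%N -> Q i *m Q j = - (Q j *m Q i).
Proof.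
move=> ij; rewrite !tensor_mul -scaleN1r -(prod_sign_at i).
rewrite -(tensor_scale (fun k => if k == i then -1 else 1)).
congr (tensor _ n); apply/funext => k.
have [ki|ik|->] := ltngtP k i.
- by rewrite (ltn_trans ki ij) scale1r.
- by rewrite scale1r mul1mx mulmx1.
- by rewrite ij scaleN1r pauliUQ opprK.
Qed.

Lemma QgenC i j : i != j -> Q i *m Q j = - (Q j *m Q i).
Proof.
rewrite neq_ltn => /orP[|] lt; first exact: QgenC_lt.
by rewrite (QgenC_lt lt) opprK.
Qed.

(** Linear combinations of monomials; by [Qgen_prod] they are stable under left
    multiplication by the generators, hence exhaust the Clifford algebra. *)
Definition span_mon A := exists c : {set 'I_n} -> C,
  A = \sum_a c a *: Qmon R a.

Lemma span_mon_scale z A : span_mon A -> span_mon (z *: A).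
Proof.
move=> [c ->]; exists (fun a => z * c a).
by rewrite scaler_sumr; apply: eq_bigr => a _; rewrite scalerA.
Qed.

Lemma span_mon_add A B : span_mon A -> span_mon B -> span_mon (A + B).
Proof.
move=> [c ->] [d ->]; exists (fun a => c a + d a).
by rewrite -big_split; apply: eq_bigr => a _; rewrite scalerDl.
Qed.

Lemma span_mon_Qmon a : span_mon (Qmon R a).
Proof.
exists (fun b => (b == a)%:R).
rewrite (bigD1 a) //= eqxx scale1r big1 ?addr0 // => b /negbTE ->.
by rewrite scale0r.
Qed.

Lemma span_mon_sum (I : finType) (F : I -> M) :
  (forall x, span_mon (F x)) -> span_mon (\sum_x F x).
Proof.
move=> h; apply: (big_ind span_mon) => //; last exact: span_mon_add.
by exists (fun=> 0); rewrite big1 // => a _; rewrite scale0r.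
Qed.

(** Moving Q_j to its place in an ordered product costs one sign for each
    generator that it passes, and Q_j^2 = 1 removes it if it is already there:
    either way the index set changes by the symmetric difference with {j}. *)
Lemma Qgen_prod j (s : seq 'I_n) (P : pred 'I_n) : uniq s -> j \in s ->
  exists e : bool, Q j *m \prod_(k <- s | P k) Q k =
    (-1) ^+ e *: \prod_(k <- s | P k (+) (k == j)) Q k.
Proof.
elim: s => [//|k s IH] /=; rewrite inE => /andP[ks us].
have [jk _|jk /= js] := eqVneq j k; first subst k.
  exists false; rewrite scale1r !big_cons eqxx addbT.
  have -> : \prod_(k <- s | P k (+) (k == j)) Q k = \prod_(k <- s | P k) Q k.
    rewrite big_seq_cond [RHS]big_seq_cond; apply: eq_bigl => k.
    have [ks'|//] := boolP (k \in s).
    by case: eqVneq => [kj|]; [rewrite -kj ks' in ks|rewrite addbF].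
  by case: (P j); rewrite //= [LHS]mulmxA Qgen_sqr mul1mx.
rewrite !big_cons (eq_sym k) (negbTE jk) addbF.
have [e IHe] := IH us js; case: (P k); last by exists e.
exists (~~ e); rewrite [LHS]mulmxA QgenC // mulNmx -mulmxA IHe.
by rewrite -scalemxAr -scaleNr -signrN.
Qed.

Lemma span_monQ j A : span_mon A -> span_mon (Q j *m A).
Proof.
move=> [c ->]; rewrite mulmx_sumr; apply: span_mon_sum => a.
rewrite -scalemxAr; apply: span_mon_scale; rewrite /Qmon.
have [|e ->] := @Qgen_prod j (index_enum 'I_n) (fun k => k \in a) (index_enum_uniq _).
  exact: mem_index_enum.
apply: span_mon_scale.
have -> : \prod_(k <- index_enum 'I_n | (k \in a) (+) (k == j)) Q k =
    Qmon R [set k | (k \in a) (+) (k == j)].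
  by rewrite /Qmon; apply: eq_bigl => k; rewrite finset.in_set.
exact: span_mon_Qmon.
Qed.

Lemma clifford_span A : clifford A -> span_mon A.
Proof.
(* Left multiplication by A preserves the span of the monomials, one of which
   is 1. *)
move=> cA; suff: forall B, span_mon B -> span_mon (A *m B).
  move=> /(_ 1%:M); rewrite mulmx1; apply.
  have <- : Qmon R finset.set0 = 1%:M :> M by rewrite /Qmon finset.big_set0.
  exact: span_mon_Qmon.
elim: cA => {A} [|j|z A _ IH|A B _ IHA _ IHB|A B _ IHA _ IHB] X hX.
- by rewrite mul1mx.
- exact: span_monQ.
- by rewrite -scalemxAl; apply/span_mon_scale/IH.
- by rewrite mulmxDl; apply: span_mon_add; [apply: IHA|apply: IHB].
- by rewrite -mulmxA; apply/IHA/IHB.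
Qed.

Lemma clifford_sum (I : eqType) (s : seq I) (P : pred I) (F : I -> M) :
  (forall x, x \in s -> clifford (F x)) -> clifford (\sum_(x <- s | P x) F x).
Proof.
move=> h; rewrite big_seq_cond; apply: (big_ind (@clifford R n)).
- by rewrite -(scale0r 1%:M); apply/clifford_scale/clifford_one.
- exact: clifford_add.
- by move=> x /andP[/h].
Qed.

Lemma clifford_opp A : clifford A -> clifford (- A).
Proof. by rewrite -scaleN1r; apply: clifford_scale. Qed.

Lemma clifford_Qmon a : clifford (Qmon R a).
Proof.
apply: (big_ind (@clifford R n)); first exact: clifford_one.
- by move=> A B; apply: clifford_mul.
- by move=> j _; apply: clifford_gen.
Qed.

Lemma tau_sum (I : Type) (s : seq I) (P : pred I) (F : I -> M) :
  tau (\sum_(x <- s | P x) F x) = \sum_(x <- s | P x) tau (F x).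
Proof. by rewrite /tau raddf_sum mulr_sumr. Qed.

Lemma tauZ z A : tau (z *: A) = z * tau A.
Proof. by rewrite /tau mxtraceZ mulrCA. Qed.

Lemma tauC A B : tau (A *m B) = tau (B *m A).
Proof. by rewrite /tau mxtrace_mulC. Qed.

(** Fourier coefficient with respect to the orthonormal basis Q^a. *)
Definition coef a A : C := tau ((Qmon R a)^t* *m A).

Lemma coefE (c : {set 'I_n} -> C) a :
  coef a (\sum_b c b *: Qmon R b) = c a.
Proof.
rewrite /coef mulmx_sumr tau_sum (bigD1 a) //= -scalemxAr tauZ tau_Qmon eqxx.
rewrite mulr1 big1 ?addr0 // => b ba.
by rewrite -scalemxAr tauZ tau_Qmon eq_sym (negbTE ba) mulr0.
Qed.

Lemma clifford_expand A : clifford A -> A = \sum_a coef a A *: Qmon R a.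
Proof.
by move=> /clifford_span[c ->]; apply: eq_bigr => a _; rewrite coefE.
Qed.

(** Conjugation by V is defined on all matrices and multiplicative there,
    unlike [Gamma], which projects onto the Clifford algebra; the two agree on
    it ([Gamma_flip]).  The lock keeps rewriting from reading [flip A] as an
    ordinary product. *)
Definition flip A := locked (V *m A *m V).

Lemma flipE A : flip A = V *m A *m V.
Proof. by rewrite /flip -lock. Qed.

Lemma flipM A B : flip (A *m B) = flip A *m flip B.
Proof. by rewrite !flipE -!mulmxA [V *m (V *m _)]mulmxA parity_sqr mul1mx. Qed.

Lemma flipK A : flip (flip A) = A.
Proof.
by rewrite !flipE !mulmxA parity_sqr mul1mx -mulmxA parity_sqr mulmx1.
Qed.

Lemma flip_adj A : (flip A)^t* = flip (A^t*).
Proof. by rewrite !flipE !(trmx_mul, map_mxM) parity_adj mulmxA. Qed.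

Lemma flip1 : flip 1%:M = 1%:M.
Proof. by rewrite !flipE mulmx1 parity_sqr. Qed.

Lemma flipQ j : flip (Q j) = - Q j.
Proof. by rewrite !flipE parityQ mulNmx -mulmxA parity_sqr mulmx1. Qed.

Lemma flip_sum (I : Type) (s : seq I) (P : pred I) (F : I -> M) :
  flip (\sum_(x <- s | P x) F x) = \sum_(x <- s | P x) flip (F x).
Proof.
rewrite flipE mulmx_sumr mulmx_suml.
by apply: eq_bigr => x _; rewrite flipE.
Qed.

Lemma flipZ z A : flip (z *: A) = z *: flip A.
Proof. by rewrite !flipE -scalemxAr -scalemxAl. Qed.

Lemma flipB A B : flip (A - B) = flip A - flip B.
Proof. by rewrite !flipE mulmxBr mulmxBl. Qed.

Lemma flipN A : flip (- A) = - flip A.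
Proof. by rewrite !flipE mulmxN mulNmx. Qed.

Lemma flip_Qmon a : flip (Qmon R a) = (-1) ^+ #|a| *: Qmon R a.
Proof.
rewrite /Qmon -sum1_card.
have -> : (-1 : C) ^+ (\sum_(j in a) 1) = \prod_(j in a) -1.
  by rewrite prodr_const sum1_card.
apply: (big_rec3 (fun X (z : C) Y => flip X = z *: Y)).
  by rewrite scale1r flip1.
move=> j X z Y _ IH; rewrite [LHS]flipM flipQ IH.
by rewrite mulN1r scaleNr mulNmx -scalemxAr.
Qed.

Lemma tau_flip A : tau (flip A) = tau A.
Proof. by rewrite !flipE tauC mulmxA parity_sqr mul1mx. Qed.

Lemma Gamma_flip A : clifford A -> Gamma A = flip A.
Proof.
move=> cA; rewrite {2}(clifford_expand cA) flip_sum; apply: eq_bigr => a _.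
by rewrite flipZ flip_Qmon scalerA mulrC.
Qed.

Lemma clifford_flip A : clifford A -> clifford (flip A).
Proof.
move=> cA; rewrite (clifford_expand cA) flip_sum; apply: clifford_sum => a _.
by rewrite flipZ flip_Qmon; do 2!apply: clifford_scale; apply: clifford_Qmon.
Qed.

End CliffordAlgebra.

(** * Conjugate transpose and Frobenius norm *)
Section Adjoint.
Set Implicit Arguments.
Unset Strict Implicit.
Unset Printing Implicit Defensive.
Local Open Scope sesquilinear_scope.
Variable R : realType.
Local Notation C := R[i].

Lemma adjM m n p (A : 'M[C]_(m, n)) (B : 'M[C]_(n, p)) :
  (A *m B)^t* = B^t* *m A^t*.
Proof. by rewrite trmx_mul map_mxM. Qed.

Lemma adjD m n (A B : 'M[C]_(m, n)) : (A + B)^t* = A^t* + B^t*.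
Proof. by apply/matrixP => i j; rewrite !mxE rmorphD. Qed.

Lemma adjN m n (A : 'M[C]_(m, n)) : (- A)^t* = - A^t*.
Proof. by apply/matrixP => i j; rewrite !mxE rmorphN. Qed.

Lemma adjB m n (A B : 'M[C]_(m, n)) : (A - B)^t* = A^t* - B^t*.
Proof. by rewrite adjD adjN. Qed.

Lemma conjC_real (x : R) : Num.conj (x%:C : C) = x%:C.
Proof. by apply: conj_Creal; apply/complex_realP; exists x. Qed.

Lemma adjZr m n (x : R) (A : 'M[C]_(m, n)) :
  (x%:C *: A)^t* = x%:C *: A^t*.
Proof. by apply/matrixP => i j; rewrite !mxE rmorphM /= conjC_real. Qed.

Lemma adj1 m : (1%:M : 'M[C]_m)^t* = 1%:M.
Proof. by rewrite trmx1 map_mx1. Qed.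

Lemma adj_sum m n (I : Type) (s : seq I) (P : pred I) (F : I -> 'M[C]_(m, n)) :
  (\sum_(x <- s | P x) F x)^t* = \sum_(x <- s | P x) (F x)^t*.
Proof. by rewrite !raddf_sum. Qed.

Lemma frob_ge0 m n (A : 'M[C]_(m, n)) : 0 <= \tr (A^t* *m A).
Proof.
apply: sumr_ge0 => i _; rewrite mxE; apply: sumr_ge0 => j _.
by rewrite !mxE mulrC -normCK exprn_ge0.
Qed.

(** The trace is the sum of the squared moduli of the entries of A. *)
Lemma frob_eq0 m n (A : 'M[C]_(m, n)) : \tr (A^t* *m A) = 0 -> A = 0.
Proof.
move=> /eqP; rewrite psumr_eq0; last first.
  move=> i _; rewrite mxE; apply: sumr_ge0 => j _.
  by rewrite !mxE mulrC -normCK exprn_ge0.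
move=> /allP h; apply/matrixP => i j; rewrite [RHS]mxE.
have := h j (mem_index_enum _); rewrite mxE psumr_eq0; last first.
  by move=> k _; rewrite !mxE mulrC -normCK exprn_ge0.
move=> /allP /(_ i (mem_index_enum _)).
by rewrite !mxE mulrC -normCK sqrf_eq0 normr_eq0 => /eqP.
Qed.

End Adjoint.

(** * Spectral projections, positivity and the Klein inequality *)
Section FunctionalCalculus.
Set Implicit Arguments.
Unset Strict Implicit.
Unset Printing Implicit Defensive.
Local Open Scope sesquilinear_scope.
Variables (R : realType) (m : nat).
Local Notation C := R[i].
Local Notation M := 'M[C]_m.
Implicit Types (A B W : M) (f g h : R -> R) (x y : R) (v : 'cV[C]_m).

Lemma hermP A : (A \is hermsymmx) <-> A^t* = A.
Proof.
split=> [/is_hermitianmxP|h]; first by rewrite expr0 scale1r => <-.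
by apply/is_hermitianmxP; rewrite expr0 scale1r h.
Qed.

(** The common shape W^-1 diag(u) W of all functions of a matrix, stated for
    arbitrary W to separate the algebra from the choice of a diagonalization. *)
Definition dconj W (u : 'rV[C]_m) : M := invmx W *m diag_mx u *m W.

Lemma dconjM W u w : W \in unitmx ->
  dconj W u *m dconj W w = dconj W (\row_i (u 0 i * w 0 i)).
Proof.
move=> uW; by rewrite /dconj -mulmx_diag -!mulmxA (mulKVmx uW).
Qed.

Lemma dconjD W u w : dconj W u + dconj W w = dconj W (u + w).
Proof. by rewrite /dconj raddfD mulmxDr mulmxDl. Qed.

Lemma dconjZ W z u : z *: dconj W u = dconj W (z *: u).
Proof. by rewrite /dconj linearZ /= -scalemxAr -scalemxAl. Qed.

Lemma dconj1 W : W \in unitmx -> dconj W (const_mx 1) = 1%:M.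
Proof. by move=> uW; rewrite /dconj diag_const_mx mulmx1 mulVmx. Qed.

Lemma dconj_adj W u : W \is unitarymx -> map_mx Num.conj u = u ->
  (dconj W u)^t* = dconj W u.
Proof.
move=> uW hu; rewrite /dconj invmx_unitary // !adjM trmxCK mulmxA.
by rewrite tr_diag_mx map_diag_mx hu.
Qed.

Definition fdiag f A : 'rV[C]_m :=
  map_mx (fun z => (f (complex.Re z))%:C) (spectral_diag A).

Lemma mxfun_dconj f A : mxfun f A = dconj (spectralmx A) (fdiag f A).
Proof. by []. Qed.

(** Without repetitions, so that [eproj A x] below is the orthogonal projection
    onto the whole eigenspace and no choice of eigenvectors remains. *)
Definition spec A : seq R :=
  undup [seq complex.Re (spectral_diag A 0 i) | i <- enum 'I_m].

Definition eproj A x : M := locked (mxfun (fun y => (y == x)%:R) A).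

Lemma eprojE A x : eproj A x = mxfun (fun y => (y == x)%:R) A.
Proof. by rewrite /eproj -lock. Qed.

Lemma spec_uniq A : uniq (spec A). Proof. exact: undup_uniq. Qed.

Lemma mem_spec A i : complex.Re (spectral_diag A 0 i) \in spec A.
Proof. by rewrite mem_undup; apply/mapP; exists i; rewrite ?mem_enum. Qed.

Lemma eq_mxfun f g A : {in spec A, f =1 g} -> mxfun f A = mxfun g A.
Proof.
move=> fg; rewrite !mxfun_dconj (_ : fdiag f A = fdiag g A) //.
by apply/rowP => i; rewrite !mxE fg ?mem_spec.
Qed.

Lemma mxfunM f g A : mxfun f A *m mxfun g A = mxfun (fun x => f x * g x) A.
Proof.
rewrite 3!mxfun_dconj dconjM; last exact: spectral_unit.
congr dconj.
by apply/rowP => i; rewrite !mxE rmorphM.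
Qed.

Lemma mxfunD f g A : mxfun f A + mxfun g A = mxfun (fun x => f x + g x) A.
Proof.
rewrite !mxfun_dconj dconjD; congr dconj.
by apply/rowP => i; rewrite !mxE rmorphD.
Qed.

Lemma mxfunZ z f A : z%:C *: mxfun f A = mxfun (fun x => z * f x) A.
Proof.
rewrite !mxfun_dconj dconjZ; congr dconj.
by apply/rowP => i; rewrite !mxE rmorphM.
Qed.

Lemma mxfun1 A : mxfun (fun=> 1) A = 1%:M.
Proof.
rewrite mxfun_dconj -(dconj1 (spectral_unit A)); congr dconj.
by apply/rowP => i; rewrite !mxE.
Qed.

Lemma mxfun_adj f A : (mxfun f A)^t* = mxfun f A.
Proof.
rewrite mxfun_dconj dconj_adj ?spectral_unitarymx //.
by apply/rowP => i; rewrite !mxE conjC_real.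
Qed.

Lemma mxfun_id A : A^t* = A -> mxfun id A = A.
Proof.
move=> /hermP hA; have /orthomx_spectralP hE := hermitian_normalmx hA.
rewrite [RHS]hE mxfun_dconj -/(dconj _ _); congr dconj; apply/rowP => i.
by rewrite !mxE RRe_real //; apply/mxOverP/hermitian_spectral_diag_real.
Qed.

Lemma mxfun_sum (I : Type) (s : seq I) (F : I -> R -> R) A :
  mxfun (fun x => \sum_(k <- s) F k x) A = \sum_(k <- s) mxfun (F k) A.
Proof.
elim: s => [|k s IH].
  rewrite big_nil -(scale0r 1%:M) -(rmorph0 (real_complex R)).
  rewrite -(mxfun1 A) mxfunZ; apply: eq_mxfun => x _.
  by rewrite big_nil mul0r.
by rewrite big_cons -IH mxfunD; apply: eq_mxfun => x _; rewrite big_cons.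
Qed.

(** Every function of A is carried by the same projections: this is the form in
    which the spectral theorem is used from here on. *)
Lemma mxfunE f A : mxfun f A = \sum_(x <- spec A) (f x)%:C *: eproj A x.
Proof.
under eq_bigr do rewrite eprojE mxfunZ.
rewrite -mxfun_sum; apply: eq_mxfun => x xA.
rewrite (bigD1_seq x) ?spec_uniq //= eqxx mulr1 big1 ?addr0 // => y.
by rewrite eq_sym => /negbTE ->; rewrite mulr0.
Qed.

Lemma eproj_sum A : \sum_(x <- spec A) eproj A x = 1%:M.
Proof.
rewrite -(mxfun1 A) mxfunE; apply: eq_bigr => x _.
by rewrite rmorph1 scale1r.
Qed.

Lemma eproj_adj A x : (eproj A x)^t* = eproj A x.
Proof. by rewrite eprojE mxfun_adj. Qed.

Lemma eproj_idem A x : eproj A x *m eproj A x = eproj A x.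
Proof.
by rewrite eprojE mxfunM; apply: eq_mxfun => y _; rewrite -natrM mulnb andbb.
Qed.

Lemma eprojM f A x : eproj A x *m mxfun f A = (f x)%:C *: eproj A x.
Proof.
rewrite eprojE mxfunM mxfunZ; apply: eq_mxfun => y _.
by case: eqP => [->|]; rewrite ?mulr1 ?mul1r // mulr0 mul0r.
Qed.

Lemma mxfun_eproj f A x : mxfun f A *m eproj A x = (f x)%:C *: eproj A x.
Proof.
rewrite eprojE mxfunM mxfunZ; apply: eq_mxfun => y _.
by case: eqP => [->|]; rewrite ?mulr1 // !mulr0.
Qed.

(** A function of a matrix depends on finitely many values only, hence is a
    polynomial in the matrix; this yields [mxfun_closed] and [mxfun_conj]. *)
Lemma interpolation (s : seq R) f :
  exists p : {poly R}, {in s, forall x, f x = p.[x]}.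
Proof.
elim: s => [|x s [p IH]]; first by exists 0.
have [xs|xs] := boolP (x \in s).
  by exists p => y; rewrite inE => /orP[/eqP ->|]; apply: IH.
pose q := \prod_(y <- s) ('X - y%:P).
have qx : q.[x] != 0.
  by move: xs; rewrite -root_prod_XsubC.
(* q vanishes on s, so adding a multiple of it changes the value at x alone. *)
exists (p + ((f x - p.[x]) / q.[x]) *: q) => y; rewrite !hornerE inE.
case/orP=> [/eqP ->|ys]; first by rewrite divfK // addrC subrK.
have -> : q.[y] = 0 by apply/rootP; rewrite root_prod_XsubC.
by rewrite mulr0 addr0 IH.
Qed.

Lemma mxfun_poly (p : {poly R}) A : A^t* = A ->
  mxfun (horner p) A = \sum_(i < size p) (p`_i)%:C *: A ^+ i.
Proof.
move=> hA; have hX k : mxfun (fun x => x ^+ k) A = A ^+ k.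
  elim: k => [|k IH]; first by rewrite expr0 -[RHS](mxfun1 A).
  rewrite exprS -IH -{2}(mxfun_id hA) [RHS]mxfunM.
  by apply: eq_mxfun => x _; rewrite exprS.
under [RHS]eq_bigr do rewrite -hX mxfunZ.
by rewrite -mxfun_sum; apply: eq_mxfun => x _; rewrite horner_coef.
Qed.

Lemma mxfun_closed (P : M -> Prop) f A : A^t* = A ->
  P 1%:M -> P A -> (forall z X, P X -> P (z *: X)) ->
  (forall X Y, P X -> P Y -> P (X + Y)) ->
  (forall X Y, P X -> P Y -> P (X *m Y)) -> P (mxfun f A).
Proof.
move=> hA P1 PA PZ PD PM; have [p hp] := interpolation (spec A) f.
rewrite (eq_mxfun hp) mxfun_poly //.
apply: (big_ind P) => //; first by rewrite -(scale0r 1%:M); apply: PZ.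
move=> k _; apply: PZ; elim: (k : nat) => [//|j IH].
by rewrite exprS; apply: PM.
Qed.

(** The two matrices have unrelated diagonalizations in [spectralmx], so one
    polynomial is chosen that interpolates f on both spectra. *)
Lemma mxfun_conj W f A : A^t* = A -> W^t* = W -> W *m W = 1%:M ->
  mxfun f (W *m A *m W) = W *m mxfun f A *m W.
Proof.
move=> hA hW WW.
have hB : (W *m A *m W)^t* = W *m A *m W by rewrite !adjM hA hW mulmxA.
have [p hp] := interpolation (spec A ++ spec (W *m A *m W)) f.
rewrite (@eq_mxfun f (horner p)); last first.
  by move=> x xs; rewrite hp // mem_cat xs orbT.
rewrite (@eq_mxfun f (horner p) A); last first.
  by move=> x xs; rewrite hp // mem_cat xs.
rewrite !mxfun_poly // mulmx_sumr mulmx_suml; apply: eq_bigr => i _.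
rewrite -scalemxAr -scalemxAl; congr (_ *: _).
elim: (i : nat) => [|k IH]; first by rewrite !expr0 [RHS](_ : _ = W *m W) ?WW ?mulmx1.
by rewrite !exprS IH -!mulmxE -!mulmxA (mulmxA W W) WW mul1mx.
Qed.

Definition sqnorm v : C := (v^t* *m v) 0 0.
Definition qform A v : C := (v^t* *m A *m v) 0 0.

Lemma sqnorm_ge0 v : 0 <= sqnorm v.
Proof.
by rewrite /sqnorm mxE; apply: sumr_ge0 => i _; rewrite !mxE mulrC -normCK exprn_ge0.
Qed.

Lemma qformD A B v : qform (A + B) v = qform A v + qform B v.
Proof. by rewrite /qform mulmxDr mulmxDl mxE. Qed.

Lemma qformZ z A v : qform (z *: A) v = z * qform A v.
Proof. by rewrite /qform -scalemxAr -scalemxAl mxE. Qed.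

Lemma qform_sum (I : Type) (s : seq I) (F : I -> M) v :
  qform (\sum_(x <- s) F x) v = \sum_(x <- s) qform (F x) v.
Proof. by rewrite /qform mulmx_sumr mulmx_suml summxE. Qed.

Lemma qform1 v : qform 1%:M v = sqnorm v.
Proof. by rewrite /qform mulmx1. Qed.

Lemma qform_conj W A v : qform (W *m A *m W^t*) v = qform A (W^t* *m v).
Proof. by rewrite /qform adjM trmxCK !mulmxA. Qed.

Lemma qform_eproj_ge0 A x v : 0 <= qform (eproj A x) v.
Proof.
rewrite -eproj_idem -{1}eproj_adj /qform !mulmxA -adjM -mulmxA.
exact: sqnorm_ge0.
Qed.

Lemma mxfun_lower f A (e : R) v : {in spec A, forall x, e <= f x} ->
  e%:C * sqnorm v <= qform (mxfun f A) v.
Proof.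
move=> h; rewrite -qform1 -(eproj_sum A) qform_sum mulr_sumr mxfunE qform_sum.
rewrite big_seq [leRHS]big_seq; apply: ler_sum => x xA; rewrite qformZ.
by rewrite ler_wpM2r ?qform_eproj_ge0 // lecR h.
Qed.

Lemma dconj_eigenvector W u i : W \is unitarymx ->
  exists2 v, sqnorm v = 1 & dconj W u *m v = u 0 i *: v.
Proof.
move=> uW; have uP := unitarymx_unit uW; have PV := invmx_unitary uW.
exists (invmx W *m delta_mx i 0).
  rewrite /sqnorm adjM {1}PV trmxCK !mulmxA -(mulmxA _ W) mulmxV // mulmx1.
  rewrite mxE (bigD1 i) //= !mxE !eqxx conjC1 mulr1 big1 ?addr0 // => j ji.
  by rewrite !mxE (negbTE ji) mulr0.
rewrite /dconj -!mulmxA mulKVmx // scalemxAr.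
congr (_ *m _); apply/matrixP => j k; rewrite mul_diag_mx !mxE.
by case: eqP => [->|] /=; rewrite ?mulr0.
Qed.

Lemma spec_eigenvector A x : A^t* = A -> x \in spec A ->
  exists2 v, sqnorm v = 1 & A *m v = x%:C *: v.
Proof.
move=> hA; rewrite mem_undup => /mapP[i _ ->].
have [v v1 Av] := dconj_eigenvector (fdiag id A) i (spectral_unitarymx A).
by exists v => //; move: Av; rewrite -mxfun_dconj mxfun_id // mxE.
Qed.

(** Coercivity instead of invertibility: a lower bound on the quadratic form is
    stable under small perturbations and under convex combinations. *)
Definition posdef A := A^t* = A /\
  exists2 e : R, 0 < e & forall v, e%:C * sqnorm v <= qform A v.

Lemma posdefP A : (mxpos A /\ A \in unitmx) <-> posdef A.
Proof.
split=> [[[/hermP hA pA] uA]|[hA [e e0 he]]].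
  split=> //; have pos x : x \in spec A -> 0 < x.
    move=> /(spec_eigenvector hA)[v v1 Av]; rewrite -ltcR lt_def.
    apply/andP; split.
      apply/eqP => x0; have : v = 0.
        by rewrite -(mulKmx uA v) Av x0 scale0r mulmx0.
      by move=> v0; move/eqP: v1; rewrite v0 /sqnorm mulmx0 mxE eq_sym oner_eq0.
    by move: (pA v); rewrite -mulmxA Av -scalemxAr mxE -/(sqnorm v) v1 mulr1.
  have [e e0 he] : exists2 e : R, 0 < e & {in spec A, forall x, e <= x}.
    elim: (spec A) pos => [|x s IH] pos; first by exists 1.
    have [|e e0 he] := IH; first by move=> y ys; apply: pos; rewrite inE ys orbT.
    exists (Num.min e x); first by rewrite lt_min e0 pos // inE eqxx.
    move=> y; rewrite inE ge_min => /orP[/eqP ->|/he ->] //.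
    by rewrite lexx orbT.
  by exists e => // v; rewrite -[in leRHS](mxfun_id hA); apply: mxfun_lower.
split.
  split; first exact/hermP.
  move=> v; apply: le_trans (he v); rewrite mulr_ge0 ?sqnorm_ge0 //.
  by rewrite ler0c ltW.
have ne0 x : x \in spec A -> x != 0.
  move=> /(spec_eigenvector hA)[v v1 Av]; apply/eqP => x0.
  have := he v; rewrite v1 mulr1 /qform -mulmxA Av x0 scale0r mulmx0 mxE.
  by rewrite lecR leNgt e0.
apply: (proj2 (@mulmx1_unit _ _ (mxfun (fun x => x^-1) A) A _)).
rewrite -{2}(mxfun_id hA) mxfunM -(mxfun1 A); apply: eq_mxfun => x xA.
by rewrite mulVf ?ne0.
Qed.

Lemma posdef_spec A : posdef A ->
  exists2 e : R, 0 < e & {in spec A, forall x, e <= x}.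
Proof.
move=> [hA [e e0 he]]; exists e => // x /(spec_eigenvector hA)[v v1 Av].
have := he v; rewrite v1 mulr1 /qform -mulmxA Av -scalemxAr mxE.
by rewrite -/(sqnorm v) v1 mulr1 lecR.
Qed.

(** With A >= e and |B| <= K, every |t| < e / (2K) leaves A + tB >= e / 2. *)
Lemma posdef_perturb A B : posdef A -> B^t* = B ->
  exists2 d : R, 0 < d & forall t : R, `|t| < d -> posdef (A + t%:C *: B).
Proof.
move=> [hA [e e0 he]] hB.
have [K K0 hK] : exists2 K : R, 0 < K & {in spec B, forall x, `|x| <= K}.
  elim: (spec B) => [|x s [K K0 IH]]; first by exists 1.
  exists (Num.max K `|x|); first by rewrite lt_max K0.
  move=> y; rewrite inE le_max => /orP[/eqP ->|/IH ->] //.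
  by rewrite lexx orbT.
(* K bounds the spectrum of B in absolute value. *)
exists (e / (2 * K)) => [|t ht]; first by rewrite divr_gt0 // mulr_gt0.
split; first by rewrite adjD adjZr hA hB.
exists (e / 2); first by rewrite divr_gt0.
move=> v; rewrite qformD; have -> : (e / 2)%:C * sqnorm v =
   e%:C * sqnorm v + (- (e / 2))%:C * sqnorm v.
  by rewrite -mulrDl -rmorphD /=; congr (_%:C * _); field.
apply: lerD => //.
have -> : t%:C *: B = mxfun (fun x => t * x) B by rewrite -mxfunZ mxfun_id.
apply: mxfun_lower => x xB; rewrite lerNl.
apply: le_trans (ler_norm _) _; rewrite normrN normrM.
apply: (@le_trans _ _ (e / (2 * K) * K)).
  by apply: ler_pM => //; [exact: ltW|exact: hK].
by rewrite le_eqVlt; apply/orP; left; apply/eqP; field; rewrite gt_eqF.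
Qed.

Lemma posdef_convex A B (p q : R) : 0 < p -> 0 <= q -> posdef A ->
  B^t* = B -> (forall v, 0 <= qform B v) -> posdef (p%:C *: A + q%:C *: B).
Proof.
move=> p0 q0 [hA [e e0 he]] hB pB.
split; first by rewrite adjD !adjZr hA hB.
exists (p * e); first by rewrite mulr_gt0.
move=> v; rewrite qformD !qformZ rmorphM -mulrA.
rewrite -[leLHS]addr0; apply: lerD; first by rewrite ler_wpM2l // ler0c ltW.
by rewrite mulr_ge0 // ler0c.
Qed.

Lemma tr_proj2_ge0 (E F : M) : E^t* = E -> F^t* = F -> E *m E = E ->
  F *m F = F -> 0 <= \tr (E *m F).
Proof.
move=> hE hF EE FF; suff -> : \tr (E *m F) = \tr ((E *m F)^t* *m (E *m F)).
  exact: frob_ge0.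
by rewrite adjM hE hF -mulmxA (mulmxA E E) EE [RHS]mxtrace_mulC -mulmxA FF.
Qed.

Lemma tr_eproj2_ge0 A B x y : 0 <= \tr (eproj A x *m eproj B y).
Proof. by apply: tr_proj2_ge0; rewrite ?eproj_adj ?eproj_idem. Qed.

Lemma tr_mxfun2 f g A B : \tr (mxfun f A *m mxfun g B) =
  \sum_(x <- spec A) \sum_(y <- spec B)
    (f x * g y)%:C * \tr (eproj A x *m eproj B y).
Proof.
rewrite !mxfunE mulmx_suml raddf_sum; apply: eq_bigr => x _ /=.
rewrite mulmx_sumr raddf_sum; apply: eq_bigr => y _ /=.
by rewrite -scalemxAl -scalemxAr !mxtraceZ mulrA rmorphM.
Qed.

Lemma ln_le_subr1 (x : R) : 0 < x -> ln x <= x - 1.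
Proof.
by move=> x0; rewrite lerBrDl -[leRHS]lnK ?posrE // expR_ge1Dx.
Qed.

(** Both bounds are ln z <= z - 1, at z = x / y and at z = y / x. *)
Lemma relative_entropy_bounds (x y : R) : 0 < x -> 0 < y ->
  0 <= y * ln y - y * ln x - y + x <= (y - x) ^+ 2 / x.
Proof.
move=> x0 y0; have h1 := ln_le_subr1 (divr_gt0 y0 x0).
have h2 := ln_le_subr1 (divr_gt0 x0 y0).
rewrite ln_div ?posrE // in h1; rewrite ln_div ?posrE // in h2.
have {}h2 := ler_wpM2l (ltW y0) h2; have {}h1 := ler_wpM2l (ltW y0) h1.
have e2 : y * (x / y - 1) = x - y by field; rewrite gt_eqF.
have e1 : y * (y / x - 1) = (y - x) ^+ 2 / x + (y - x) by field; rewrite gt_eqF.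
rewrite e2 in h2; rewrite e1 in h1.
by apply/andP; split; lra.
Qed.

(** Klein's inequality with a quadratic upper bound.  With E_x, F_y the spectral
    projections of A and B, each of the traces is a sum over (x, y) against the
    nonnegative weights tr (E_x F_y), so that the scalar inequalities
    [relative_entropy_bounds] can be summed. *)
Lemma klein A B (e : R) : 0 < e -> A^t* = A -> B^t* = B ->
  {in spec A, forall x, e <= x} -> {in spec B, forall y, 0 < y} ->
  let S := \tr (B *m mxlog B) - \tr (B *m mxlog A) - \tr B + \tr A in
  0 <= S /\ S <= (e^-1)%:C * \tr ((B - A)^t* *m (B - A)).
Proof.
move=> e0 hA hB pA pB S.
pose w x y := \tr (eproj A x *m eproj B y).
pose D (c : R -> R -> R) : C :=
  \sum_(x <- spec A) \sum_(y <- spec B) (c x y)%:C * w x y.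
have DB c d : D c - D d = D (fun x y => c x y - d x y).
  rewrite /D -sumrB; apply: eq_bigr => x _; rewrite -sumrB.
  by apply: eq_bigr => y _; rewrite -mulrBl -rmorphB.
have DD c d : D c + D d = D (fun x y => c x y + d x y).
  rewrite /D -big_split; apply: eq_bigr => x _; rewrite -big_split.
  by apply: eq_bigr => y _; rewrite /= -mulrDl -rmorphD.
have DE f g : \tr (mxfun f A *m mxfun g B) = D (fun x y => f x * g y).
  exact: tr_mxfun2.
have D1 g : \tr (mxfun g B) = D (fun x y => g y).
  rewrite -[mxfun g B]mul1mx -(mxfun1 A) DE.
  by apply: eq_bigr => x _; apply: eq_bigr => y _; rewrite mul1r.
have D2 f : \tr (mxfun f A) = D (fun x y => f x).
  rewrite -[mxfun f A]mulmx1 -(mxfun1 B) DE.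
  by apply: eq_bigr => x _; apply: eq_bigr => y _; rewrite mulr1.
have E1 : \tr (B *m mxlog B) = D (fun x y => y * ln y).
  by rewrite -{1}(mxfun_id hB) mxfunM D1.
have E2 : \tr (B *m mxlog A) = D (fun x y => ln x * y).
  by rewrite -{1}(mxfun_id hB) mxtrace_mulC DE.
have E3 : \tr B = D (fun x y => y) by rewrite -{1}(mxfun_id hB) D1.
have E4 : \tr A = D (fun x y => x) by rewrite -{1}(mxfun_id hA) D2.
have E5 : \tr (A *m B) = D (fun x y => x * y).
  by rewrite -{1}(mxfun_id hA) -{1}(mxfun_id hB) DE.
have E6 : \tr (B *m B) = D (fun x y => y * y).
  by rewrite -{1}(mxfun_id hB) -{2}(mxfun_id hB) mxfunM D1.
have E7 : \tr (A *m A) = D (fun x y => x * x).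
  by rewrite -{1}(mxfun_id hA) -{2}(mxfun_id hA) mxfunM D2.
have E8 : \tr ((B - A)^t* *m (B - A)) = D (fun x y => (y - x) ^+ 2).
  rewrite adjB hA hB mulmxBl !mulmxBr !raddfB /= (mxtrace_mulC B A).
  rewrite E5 E6 E7 opprK [- _ + _]addrC !DB DD.
  apply: eq_bigr => x _; apply: eq_bigr => y _.
  by congr (_%:C * _); ring.
have ES : S = D (fun x y => y * ln y - y * ln x - y + x).
  have -> : S = D (fun x y => y * ln y) - D (fun x y => ln x * y) -
      (D (fun x y => y) - D (fun x y => x)).
    have rearrange (a b c d a' b' c' d' : C) : a = a' -> b = b' -> c = c' ->
        d = d' -> a - b - c + d = a' - b' - (c' - d').
      by move=> -> -> -> ->; rewrite opprB addrA addrAC.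
    exact: rearrange E1 E2 E3 E4.
  rewrite !DB; apply: eq_bigr => x _; apply: eq_bigr => y _.
  by congr (_%:C * _); ring.
have wge x y : 0 <= w x y by exact: tr_eproj2_ge0.
rewrite ES E8; clear -e0 pA pB wge.
split.
  rewrite /D big_seq; apply: sumr_ge0 => x xA; rewrite big_seq.
  apply: sumr_ge0 => y yB; rewrite mulr_ge0 // ler0c.
  have x0 : 0 < x by exact: lt_le_trans (pA x xA).
  by have /andP[] := relative_entropy_bounds x0 (pB y yB).
rewrite /D mulr_sumr big_seq [leRHS]big_seq; apply: ler_sum => x xA.
rewrite mulr_sumr big_seq [leRHS]big_seq; apply: ler_sum => y yB.
rewrite mulrA -rmorphM ler_wpM2r // lecR.
have x0 : 0 < x by exact: lt_le_trans (pA x xA).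
have /andP[_ h] := relative_entropy_bounds x0 (pB y yB).
apply: le_trans h _; rewrite mulrC ler_wpM2r ?sqr_ge0 //.
by rewrite lef_pV2 ?posrE // pA.
Qed.

End FunctionalCalculus.

(** * Derivatives on the half-line and the logarithmic mean *)
Section RealCalculus.
Set Implicit Arguments.
Unset Strict Implicit.
Unset Printing Implicit Defensive.
Import numFieldNormedType.Exports.
Local Open Scope classical_set_scope.
Variable R : realType.
Implicit Types (f g r q : R -> R) (t l x y : R).

Lemma near_dnbhs_shift t (P : R -> Prop) :
  (\forall h \near 0^', P (h + t)) <-> (\forall s \near t^', P s).
Proof.
split=> /nbhs_ballP[e /= e0 he]; apply/nbhs_ballP; exists e => // s hs s0.
- rewrite -(subrK t s); apply: he; last by rewrite subr_eq0.
  by move: hs; rewrite /ball /= sub0r opprB.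
- apply: he; last by rewrite -subr_eq0 addrK.
  by move: hs; rewrite /ball /= sub0r normrN opprD addrCA subrr addr0 normrN.
Qed.

Lemma is_derive_quotient f t l :
  is_derive t 1 f l <-> (f s - f t) / (s - t) @[s --> t^'] --> l.
Proof.
have E : (h^-1 *: (f (h *: 1 + t) - f t) @[h --> 0^'] --> l) <->
         ((f s - f t) / (s - t) @[s --> t^'] --> l).
  rewrite !cvgrPdist_lt; split=> H e e0; have := H e e0.
    rewrite -(near_dnbhs_shift t); apply: filterS => h.
    by rewrite addrK /GRing.scale /= mulr1 mulrC.
  rewrite -(near_dnbhs_shift t); apply: filterS => h.
  by rewrite addrK /GRing.scale /= mulr1 mulrC.
rewrite -E; split=> [[df <-]|h]; first exact: df.
by split; [apply/cvg_ex; exists l|exact/cvg_lim].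
Qed.

Lemma halfline_derive f g t l : is_derive t 1 f l ->
  (forall s, 0 <= s -> g s = f s) -> 0 <= t -> is_halfline_derive g t l.
Proof.
move=> /is_derive_quotient; rewrite /is_halfline_derive !cvgrPdist_lt.
move=> H fg t0 e e0; have := H e e0; rewrite !near_withinE.
by apply: filterS => s hs st s0; rewrite !fg //; apply: hs.
Qed.

Lemma derive_of_halfline f t l : 0 < t -> is_halfline_derive f t l ->
  is_derive t 1 f l.
Proof.
move=> t0; rewrite is_derive_quotient /is_halfline_derive !cvgrPdist_lt.
move=> H e e0; have := H e e0; rewrite !near_withinE => {}H.
have pos : \forall s \near t, 0 <= s.
  have := lt_nbhsr t0; apply: filterS => s; exact: ltW.
by near=> s => st; apply: (near H s) => //; near: s.
Unshelve. all: by end_near. Qed.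

Lemma halfline_continuous f t l : is_halfline_derive f t l ->
  f s @[s --> within [set s | 0 <= s] (nbhs t)] --> f t.
Proof.
rewrite /is_halfline_derive !cvgrPdist_lt => H e e0.
have := H 1 ltr01; rewrite !near_withinE => {}H.
(* Near t the difference quotient is bounded by |l| + 1. *)
have l0 : 0 < `|l| + 1 by rewrite ltr_pwDr.
have de0 : 0 < e / (`|l| + 1) by rewrite divr_gt0.
have near_t : \forall s \near t, `|t - s| < e / (`|l| + 1).
  exact: (nbhsx_ballx t _ de0).
near=> s => s0.
have [->|st] := eqVneq s t; first by rewrite subrr normr0.
have hs : `|l - (f s - f t) / (s - t)| < 1 by apply: (near H s).
have ht : `|t - s| < e / (`|l| + 1) by near: s.
have st0 : s - t != 0 by rewrite subr_eq0.
have {hs}: `|(f s - f t) / (s - t)| <= `|l| + 1.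
  rewrite -[X in `|X|](subKr l) opprB; apply: le_trans (ler_normD _ _) _.
  by rewrite lerD2l distrC ltW.
rewrite normrM normfV ler_pdivrMr ?normr_gt0 // distrC => hs.
apply: le_lt_trans hs _; rewrite distrC mulrC -ltr_pdivlMr //.
Unshelve. all: by end_near. Qed.

(** The function e^{at} f(t) has derivative 0 on the open half-line and is
    continuous at the end point. *)
Lemma halfline_exp_unique (a : R) f :
  (forall t, 0 <= t -> is_halfline_derive f t (- a * f t)) ->
  forall t, 0 <= t -> f t = expR (- a * t) * f 0.
Proof.
move=> hf t t0; pose g s := expR (a * s) * f s.
suff : g t = g 0.
  rewrite /g mulr0 expR0 mul1r => <-.
  by rewrite mulrA -expRD mulNr addNr expR0 mul1r.
move: t0; rewrite le_eqVlt => /orP[/eqP <- //|t0].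
have dg (s : R) : s \in `]0, t[%R -> is_derive s 1 g 0.
  rewrite in_itv /= => /andP[s0 _].
  have df := derive_of_halfline s0 (hf s (ltW s0)).
  have -> : 0 = expR (a * s) *: (- a * f s) + f s *: (a * expR (a * s)).
    by rewrite /GRing.scale /=; ring.
  apply: is_deriveM.
  have d1 : is_derive s 1 (fun s => a * s) a.
    by apply: is_derive_eq; rewrite /GRing.scale /= !mulr1.
  have := @is_derive1_comp _ expR (fun s => a * s) s _ _ (is_derive_expR _) d1.
  by rewrite mulrC.
have cg : {within `[0, t], continuous g}.
  apply/subspace_continuousP => s; rewrite /= in_itv /= => /andP[s0 _].
  have hfs := halfline_continuous (hf s s0).
  apply: cvgM; last first.
    move: hfs; apply: cvg_trans; apply: cvg_app; apply: within_subset => u.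
    by rewrite /= in_itv /= => /andP[].
  apply: cvg_within_filter; apply: continuous_comp.
    by apply: cvgM; [exact: cvg_cst|exact: cvg_id].
  exact: continuous_expR.
have [c _] := MVT t0 dg cg.
by rewrite mul0r => /eqP; rewrite subr_eq0 => /eqP.
Qed.

(** The difference quotients of r at 0 are bounded by K times those of q. *)
Lemma squeeze_derive r q (K : R) : q 0 = 0 -> is_derive (0 : R) 1 q 0 ->
  (\forall t \near (0 : R), 0 <= r t <= K * q t) -> is_derive (0 : R) 1 r 0.
Proof.
move=> q0 /is_derive_quotient dq H; apply/is_derive_quotient.
have r0 : r 0 = 0.
  have := nbhs_singleton H; rewrite q0 mulr0 => h.
  by apply/eqP; rewrite eq_le andbC.
have {}dq : K * ((q s - q 0) / (s - 0)) @[s --> 0^'] --> (0 : R).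
  by rewrite -[X in _ --> X](mulr0 K); apply: cvgM; [exact: cvg_cst|exact: dq].
move: dq; rewrite !cvgrPdist_lt => dq e e0.
have := dq e e0; rewrite !near_withinE => {}dq.
near=> s => s0.
have h1 : `|0 - K * ((q s - q 0) / (s - 0))| < e by apply: (near dq s).
have /andP[h2 h3] : 0 <= r s <= K * q s by near: s.
apply: le_lt_trans h1; rewrite r0 q0 !subr0 !sub0r !normrN mulrA !normrM.
by rewrite ler_wpM2r // -normrM !ger0_norm // (le_trans h2).
Unshelve. all: by end_near. Qed.

Lemma affine_smooth (a b e : R) : smooth_on e (fun t => a + t * b).
Proof.
have d1 t : is_derive t 1 (fun t => a + t * b) b.
  by apply: is_derive_eq; rewrite /GRing.scale /=; ring.
have dk k : exists c, (fun t => a + t * b)^`(k.+1) = cst c.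
  elim: k => [|k [c IH]].
    exists b; apply/funext => t; rewrite derive1n1 derive1E.
    exact: derive_val.
  by exists 0; rewrite derive1nS IH; apply/funext => t; rewrite derive1_cst.
case=> [|k] t _; first by rewrite /derive1n /=; case: (d1 t).
by have [c ->] := dk k; apply: derivable_cst.
Qed.

Lemma affine_derive1 (a b t : R) : (fun t => a + t * b)^`() t = b.
Proof.
rewrite derive1E; apply: derive_val.
by apply: is_derive_eq; rewrite /GRing.scale /=; ring.
Qed.

(** The logarithmic mean of x and y, see [powmeanE]. *)
Definition powmean x y : R :=
  \int[@lebesgue_measure R]_(s in `[0, 1]) (x `^ (1 - s) * y `^ s).

(** In this form the integrand has an explicit primitive in s. *)
Lemma powR_interp x y s : 0 < x -> 0 < y ->
  x `^ (1 - s) * y `^ s = x * expR (s * (ln y - ln x)).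
Proof.
move=> x0 y0; rewrite /powR !gt_eqF // -expRD.
rewrite -{2}(lnK (_ : x \is Num.pos)) ?posrE // -expRD.
by congr expR; ring.
Qed.

Lemma continuous_interp (x k : R) : continuous (fun s : R => x * expR (s * k)).
Proof.
move=> s; apply: cvgM; first exact: cvg_cst.
apply: continuous_comp; last exact: continuous_expR.
by apply: cvgM; [exact: cvg_id|exact: cvg_cst].
Qed.

Lemma integrable_powR x y : 0 < x -> 0 < y ->
  (@lebesgue_measure R).-integrable `[0, 1]
    (EFin \o (fun s => x `^ (1 - s) * y `^ s)).
Proof.
move=> x0 y0; apply: continuous_compact_integrable; first exact: segment_compact.
apply: continuous_subspaceT.
rewrite (_ : (fun s => _) = fun s => x * expR (s * (ln y - ln x))).
  exact: continuous_interp.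
by apply/funext => s; rewrite powR_interp.
Qed.

Lemma powmeanE x y : 0 < x -> 0 < y ->
  powmean x y = if x == y then x else (y - x) / (ln y - ln x).
Proof.
move=> x0 y0; rewrite /powmean.
have E : (fun s => x `^ (1 - s) * y `^ s) =
         fun s => x * expR (s * (ln y - ln x)).
  by apply/funext => s; rewrite powR_interp.
rewrite E; case: eqVneq => [<-|xy].
  rewrite subrr (_ : (fun s : R => _) = fun=> x); last first.
    by apply/funext => s; rewrite mulr0 expR0 mulr1.
  rewrite Rintegral_cst; last exact: measurable_itv.
  have := @lebesgue_measure_itv R `[0, 1]%R; rewrite /= lte_fin ltr01 oppr0 addr0.
  by move=> ->; rewrite mulr1.
set k := ln y - ln x.
have k0 : k != 0.
  rewrite subr_eq0; apply: contra_neq xy => lyx.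
  by apply: ln_inj; rewrite ?posrE.
(* A primitive of x e^{ks}. *)
pose F (s : R) := expR (s * k) * (x / k).
have dF (s : R) : is_derive s 1 F (x * expR (s * k)).
  have d1 : is_derive s 1 (fun s => s * k) k.
    by apply: is_derive_eq; rewrite /GRing.scale /=; ring.
  have d2 := @is_derive1_comp _ expR _ s _ _ (is_derive_expR _) d1.
  rewrite /F; apply: is_derive_eq.
  by rewrite scaler0 add0r /GRing.scale /=; field.
have cF : continuous F.
  by move=> s; apply/differentiable_continuous/derivable1_diffP; case: (dF s).
rewrite /Rintegral (@continuous_FTC2 _ _ F) //.
- rewrite /= /F mul0r mul1r expR0 mul1r /k -ln_div ?posrE // lnK; last first.
    by rewrite posrE divr_gt0.
  by rewrite ln_div ?posrE // -/k; field; rewrite k0 gt_eqF.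
- by apply: continuous_subspaceT; exact: continuous_interp.
- split=> [s _||]; first by case: (dF s).
  + exact/cvg_at_right_filter/cF.
  + exact/cvg_at_left_filter/cF.
- by move=> s _; rewrite derive1E; exact: derive_val.
Qed.

Lemma powmean_log x y : 0 < x -> 0 < y ->
  powmean x y * (ln y - ln x) = y - x.
Proof.
move=> x0 y0; rewrite powmeanE //; case: eqVneq => [->|xy].
  by rewrite !subrr mulr0.
rewrite divfK // subr_eq0; apply: contra_neq xy => lyx.
by apply: ln_inj; rewrite ?posrE.
Qed.

Lemma powmeanC x y : 0 < x -> 0 < y -> powmean x y = powmean y x.
Proof.
move=> x0 y0; rewrite !powmeanE // eq_sym; case: eqVneq => [->//|xy].
by rewrite -(opprB x) -(opprB (ln x)) invrN mulrNN.
Qed.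

Lemma powmean_gt0 x y : 0 < x -> 0 < y -> 0 < powmean x y.
Proof.
move=> x0 y0; rewrite powmeanE //; case: (ltgtP x y) => // xy.
  by rewrite divr_gt0 // subr_gt0 // ltr_ln ?posrE.
by rewrite -mulrNN -invrN !opprB divr_gt0 // subr_gt0 // ltr_ln ?posrE.
Qed.

End RealCalculus.

(** * Entrywise limits of matrix-valued functions *)
Section MatrixCalculus.
Set Implicit Arguments.
Unset Strict Implicit.
Unset Printing Implicit Defensive.
Import numFieldNormedType.Exports.
Local Open Scope classical_set_scope.
Local Open Scope sesquilinear_scope.
Variables (R : realType) (m : nat).
Local Notation C := R[i].
Local Notation M := 'M[C]_m.

Lemma ReD (z w : C) : complex.Re (z + w) = complex.Re z + complex.Re w.
Proof. by case: z; case: w. Qed.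

Lemma ImD (z w : C) : complex.Im (z + w) = complex.Im z + complex.Im w.
Proof. by case: z; case: w. Qed.

Lemma ReB (z w : C) : complex.Re (z - w) = complex.Re z - complex.Re w.
Proof. by case: z; case: w. Qed.

Lemma ImB (z w : C) : complex.Im (z - w) = complex.Im z - complex.Im w.
Proof. by case: z; case: w. Qed.

Lemma Re_sum (I : Type) (s : seq I) (F : I -> C) :
  complex.Re (\sum_(k <- s) F k) = \sum_(k <- s) complex.Re (F k).
Proof. by apply: (big_morph _ ReD). Qed.

Lemma Im_sum (I : Type) (s : seq I) (F : I -> C) :
  complex.Im (\sum_(k <- s) F k) = \sum_(k <- s) complex.Im (F k).
Proof. by apply: (big_morph _ ImD). Qed.

Lemma ReZ (x : R) (z : C) : complex.Re (x%:C * z) = x * complex.Re z.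
Proof. by case: z => a b /=; rewrite mul0r subr0. Qed.

Lemma ImZ (x : R) (z : C) : complex.Im (x%:C * z) = x * complex.Im z.
Proof. by case: z => a b /=; rewrite mul0r addr0. Qed.

Lemma ReM (z w : C) : complex.Re (z * w) =
  complex.Re z * complex.Re w - complex.Im z * complex.Im w.
Proof. by case: z; case: w. Qed.

Lemma Re_entry (I : Type) (s : seq I) (g : I -> R) (B : I -> M) i j :
  complex.Re ((\sum_(k <- s) (g k)%:C *: B k) i j) =
  \sum_(k <- s) g k * complex.Re (B k i j).
Proof. by rewrite summxE Re_sum; apply: eq_bigr => k _; rewrite mxE ReZ. Qed.

Lemma Im_entry (I : Type) (s : seq I) (g : I -> R) (B : I -> M) i j :
  complex.Im ((\sum_(k <- s) (g k)%:C *: B k) i j) =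
  \sum_(k <- s) g k * complex.Im (B k i j).
Proof. by rewrite summxE Im_sum; apply: eq_bigr => k _; rewrite mxE ImZ. Qed.

(** The matrix-valued functions met below are finite sums of real functions
    times constant matrices; on these an entrywise operation L acts on the real
    factors as soon as it is linear on their span. *)
Lemma mxlift_sum (T I : Type) (L : (T -> R) -> R) (s : seq I)
    (g : I -> T -> R) (B : I -> M) :
  (forall a : I -> R, L (fun x => \sum_(k <- s) g k x * a k) =
                      \sum_(k <- s) L (g k) * a k) ->
  mxlift L (fun x => \sum_(k <- s) (g k x)%:C *: B k) =
  \sum_(k <- s) (L (g k))%:C *: B k.
Proof.
move=> hL; apply/matrixP => i j; rewrite mxE; apply/eqP.
rewrite eq_complex Re_entry Im_entry /= -!hL; apply/andP; split.
  by apply/eqP; congr L; apply/funext => x; rewrite Re_entry.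
by apply/eqP; congr L; apply/funext => x; rewrite Im_entry.
Qed.

Lemma mxintegral01_sum (I : eqType) (s : seq I) (g : I -> R -> R)
    (B : I -> M) :
  (forall k, k \in s -> (@lebesgue_measure R).-integrable `[0, 1]
     (EFin \o g k)) ->
  mxintegral01 (fun x => \sum_(k <- s) (g k x)%:C *: B k) =
  \sum_(k <- s) (\int[@lebesgue_measure R]_(x in `[0, 1]) g k x)%:C *: B k.
Proof.
move=> hg; apply: (mxlift_sum (L := fun f =>
  \int[@lebesgue_measure R]_(x in `[0, 1]) f x)) => a.
have mI : measurable (`[0, 1] : set R) by exact: measurable_itv.
suff [] : (@lebesgue_measure R).-integrable `[0, 1]
    (EFin \o (fun x => \sum_(k <- s) g k x * a k)) /\
  \int[@lebesgue_measure R]_(x in `[0, 1]) (\sum_(k <- s) g k x * a k) =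
  \sum_(k <- s) (\int[@lebesgue_measure R]_(x in `[0, 1]) g k x) * a k by [].
elim: s hg => [|k s IH] hg.
  rewrite big_nil; under [X in Rintegral _ _ X]eq_fun do rewrite big_nil.
  rewrite Rintegral_cst // mul0r; split=> //.
  rewrite (_ : _ \o _ = cst 0%E); first exact: integrable0.
  by apply/funext => x /=; rewrite big_nil.
have [|i1 e1] := IH; first by move=> l ls; apply: hg; rewrite inE ls orbT.
have i2 : (@lebesgue_measure R).-integrable `[0, 1]
    (EFin \o (fun x => g k x * a k)).
  have -> : EFin \o (fun x => g k x * a k) =
    fun x => ((a k)%:E * (EFin \o g k) x)%E.
    by apply/funext => x /=; rewrite mulrC EFinM.
  by apply: integrableZl => //; apply: hg; rewrite inE eqxx.
have E : (fun x => \sum_(l <- k :: s) g l x * a l) =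
         (fun x => g k x * a k + \sum_(l <- s) g l x * a l).
  by apply/funext => x; rewrite big_cons.
rewrite E big_cons RintegralD // e1 RintegralZr //; last first.
  by apply: hg; rewrite inE eqxx.
split=> //.
have -> : EFin \o (fun x => g k x * a k + \sum_(l <- s) g l x * a l) =
  (EFin \o (fun x => g k x * a k)) \+ (EFin \o (fun x => \sum_(l <- s) g l x * a l)).
  by apply/funext => x.
exact: integrableD.
Qed.

Lemma mxseries_sum (I : Type) (s : seq I) (g : I -> nat -> R) (B : I -> M) :
  (forall k, cvgn (series (g k))) ->
  mxseries (fun x => \sum_(k <- s) (g k x)%:C *: B k) =
  \sum_(k <- s) (limn (series (g k)))%:C *: B k.
Proof.
move=> hg; apply: (mxlift_sum (L := fun u => limn (series u))) => a.
apply: cvg_lim => //.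
have -> : series (fun x => \sum_(k <- s) g k x * a k) =
          fun N => \sum_(k <- s) series (g k) N * a k.
  apply/funext => N; rewrite /series /= exchange_big /=.
  by apply: eq_bigr => k _; rewrite mulr_suml.
elim: s => [|k s IH].
  rewrite big_nil; under eq_fun do rewrite big_nil; exact: cvg_cst.
rewrite big_cons; under eq_fun do rewrite big_cons.
by apply: cvgD IH; apply: cvgM; [exact: hg|exact: cvg_cst].
Qed.

Section Quotients.
Variables (F : set_system R) (FF : Filter F) (t : R).
Implicit Types (f : R -> R) (l : R).
Local Notation quot f := (fun s : R => (f s - f t) / (s - t)).

(** Difference quotients along an arbitrary filter, so that the two-sided
    derivative and the derivative on the half-line are treated together. *)
Lemma quotient_scale f l (a : R) : quot f s @[s --> F] --> l ->
  quot (fun s => f s * a) s @[s --> F] --> l * a.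
Proof.
move=> h.
rewrite (_ : (fun s => _) = fun s => quot f s * a).
  by apply: cvgM; [exact: h|exact: cvg_cst].
by apply/funext => s; rewrite -mulrBl mulrAC.
Qed.

Lemma quotient_sum (I : Type) (u : seq I) (f : I -> R -> R) (l : I -> R) :
  (forall k, quot (f k) s @[s --> F] --> l k) ->
  quot (fun s => \sum_(k <- u) f k s) s @[s --> F] --> \sum_(k <- u) l k.
Proof.
move=> h.
rewrite (_ : (fun s => _) = fun s => \sum_(k <- u) quot (f k) s).
  elim: u => [|k u IH].
    rewrite big_nil; under eq_fun do rewrite big_nil; exact: cvg_cst.
  rewrite big_cons; under eq_fun do rewrite big_cons.
  by apply: cvgD => //; apply: h.
by apply/funext => s; rewrite -sumrB mulr_suml.
Qed.

(** Every real-linear functional of a matrix has the form X |-> Re tr (A X). *)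
Lemma quotient_Re_tr (c : R -> M) (D A : M) :
  (forall i j,
     quot (fun s => complex.Re (c s i j)) s @[s --> F] --> complex.Re (D i j) /\
     quot (fun s => complex.Im (c s i j)) s @[s --> F] --> complex.Im (D i j)) ->
  quot (fun s => complex.Re (\tr (A *m c s))) s @[s --> F] -->
    complex.Re (\tr (A *m D)).
Proof.
move=> h.
have E X : complex.Re (\tr (A *m X)) = \sum_i \sum_j
    (complex.Re (X j i) * complex.Re (A i j) +
     complex.Im (X j i) * - complex.Im (A i j)).
  rewrite /mxtrace Re_sum; apply: eq_bigr => i _; rewrite mxE Re_sum.
  by apply: eq_bigr => j _; rewrite ReM mulrC mulrN [X in _ - X]mulrC.
pose e (X : M) := \sum_i \sum_j
    (complex.Re (X j i) * complex.Re (A i j) +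
     complex.Im (X j i) * - complex.Im (A i j)).
rewrite (E D) (_ : (fun s => _) = quot (fun s => e (c s))); last first.
  by apply/funext => s; rewrite !E.
apply: (@quotient_sum _ _ (fun k s => \sum_j _)) => i.
apply: (@quotient_sum _ _ (fun j s => _ + _)) => j.
have [hRe hIm] := h j i.
rewrite (_ : (fun s => _) =
  quot (fun s => complex.Re (c s j i) * complex.Re (A i j)) \+
  quot (fun s => complex.Im (c s j i) * - complex.Im (A i j))).
  have h1 := @quotient_scale (fun s => complex.Re (c s j i)) _
    (complex.Re (A i j)) hRe.
  have h2 := @quotient_scale (fun s => complex.Im (c s j i)) _
    (- complex.Im (A i j)) hIm.
  exact: cvgD h1 h2.
by apply/funext => s /=; rewrite -mulrDl opprD addrACA.
Qed.

End Quotients.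

Lemma is_derive_comb (I : Type) (u : seq I) (f : I -> R -> R) (df b : I -> R)
    (t : R) :
  (forall k, is_derive t 1 (f k) (df k)) ->
  is_derive t 1 (fun s => \sum_(k <- u) f k s * b k) (\sum_(k <- u) df k * b k).
Proof.
move=> h; apply/is_derive_quotient.
apply: (@quotient_sum _ _ _ _ _ (fun k s => f k s * b k)) => k.
by apply: quotient_scale; apply/is_derive_quotient.
Qed.

(** The squared distance to c(0) is a sum of squares of functions that vanish
    at 0. *)
Lemma frob_derive (c : R -> M) (D : M) :
  (forall i j,
     is_derive (0 : R) 1 (fun s => complex.Re (c s i j)) (complex.Re (D i j)) /\
     is_derive (0 : R) 1 (fun s => complex.Im (c s i j)) (complex.Im (D i j))) ->
  is_derive (0 : R) 1
    (fun s => complex.Re (\tr ((c s - c 0)^t* *m (c s - c 0)))) 0.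
Proof.
move=> h.
have E (X : M) : complex.Re (\tr (X^t* *m X)) = \sum_i \sum_j
    ((complex.Re (X j i)) ^+ 2 + (complex.Im (X j i)) ^+ 2).
  rewrite /mxtrace Re_sum; apply: eq_bigr => i _; rewrite mxE Re_sum.
  apply: eq_bigr => j _; rewrite !mxE; case: (X j i) => a b /=.
  by rewrite mulNr opprK !expr2.
have sqr (f : R -> R) (l : R) : is_derive (0 : R) 1 f l ->
    is_derive (0 : R) 1 (fun s => (f s - f 0) ^+ 2) 0.
  move=> df; apply: is_derive_eq.
  by rewrite /GRing.scale /= subrr; ring.
apply/is_derive_quotient; rewrite (_ : (fun s => _) = fun s => 
  ((\sum_i \sum_j ((complex.Re (c s j i) - complex.Re (c 0 j i)) ^+ 2 +
     (complex.Im (c s j i) - complex.Im (c 0 j i)) ^+ 2)) -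
   (\sum_i \sum_j ((complex.Re (c 0 j i) - complex.Re (c 0 j i)) ^+ 2 +
     (complex.Im (c 0 j i) - complex.Im (c 0 j i)) ^+ 2))) / (s - 0)).
  rewrite -[X in _ --> X](_ : \sum_(i < m) \sum_(j < m) (0 + 0) = 0 :> R);
    last by rewrite big1 // => i _; rewrite big1 // => j _; rewrite addr0.
  apply: (@quotient_sum _ _ _ _ _ (fun k s => \sum_j _)) => i.
  apply: (@quotient_sum _ _ _ _ _ (fun j s => _ + _)) => j.
  have [/sqr hRe /sqr hIm] := h j i.
  by apply/is_derive_quotient; apply: is_deriveD.
apply/funext => s; rewrite !E; congr ((_ - _) / _).
  by apply: eq_bigr => i _; apply: eq_bigr => j _; rewrite !mxE ReB ImB.
by apply: eq_bigr => i _; apply: eq_bigr => j _; rewrite !mxE ReB ImB.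
Qed.

End MatrixCalculus.

(** * The weighted gradient and the metric *)
Section FermionicCalculus.
Set Implicit Arguments.
Unset Strict Implicit.
Unset Printing Implicit Defensive.
Local Open Scope sesquilinear_scope.
Variables (R : realType) (n : nat).
Local Notation C := R[i].
Local Notation M := 'M[C]_(2 ^ n).
Local Notation Q := (@Qgen R n).
Implicit Types (A B U rho : M) (i j : 'I_n) (a b : {set 'I_n}) (k l : R -> R -> R)
  (X : 'I_n -> M).

Lemma clifford_mxfun f A : A^t* = A -> clifford A -> clifford (mxfun f A).
Proof.
move=> hA cA; apply: mxfun_closed => //; first exact: clifford_one.
- by move=> z B; apply: clifford_scale.
- exact: clifford_add.
- by move=> B D; apply: clifford_mul.
Qed.

Lemma clifford_eproj A x : A^t* = A -> clifford A -> clifford (eproj A x).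
Proof. by move=> hA cA; rewrite eprojE; apply: clifford_mxfun. Qed.

Lemma mxfun_flip f A : A^t* = A -> mxfun f (flip A) = flip (mxfun f A).
Proof.
by move=> hA; rewrite !flipE mxfun_conj ?parity_adj ?parity_sqr.
Qed.

Lemma pdensityP rho :
  pdensity rho <-> [/\ clifford rho, posdef rho & tau rho = 1].
Proof.
split=> [[[c p t] u]|[c /posdefP[p u] t]]; last by split.
by split=> //; apply/posdefP.
Qed.

Lemma clifford_sub A B : clifford A -> clifford B -> clifford (A - B).
Proof. by move=> cA cB; apply/clifford_add/clifford_opp. Qed.

(** Schur multiplier: multiplication of the (x, y) block of A by k x y, rows
    being decomposed along the spectral projections of flip rho and columns
    along those of rho. *)
Definition schur k rho A : M := \sum_(x <- spec rho) \sum_(y <- spec rho)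
  (k x y)%:C *: (flip (eproj rho x) *m A *m eproj rho y).

Lemma eq_schur k l rho A :
  {in spec rho &, forall x y, k x y = l x y} -> schur k rho A = schur l rho A.
Proof.
move=> kl; rewrite /schur !big_seq; apply: eq_bigr => x xs.
by rewrite !big_seq; apply: eq_bigr => y ys; rewrite kl.
Qed.

Lemma schurB k rho A B : schur k rho (A - B) = schur k rho A - schur k rho B.
Proof.
rewrite /schur -sumrB; apply: eq_bigr => x _; rewrite -sumrB.
by apply: eq_bigr => y _; rewrite mulmxBr mulmxBl scalerBr.
Qed.

Lemma schurZ k rho z A : schur k rho (z *: A) = z *: schur k rho A.
Proof.
rewrite /schur scaler_sumr; apply: eq_bigr => x _; rewrite scaler_sumr.
by apply: eq_bigr => y _; rewrite -scalemxAr -scalemxAl !scalerA mulrC.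
Qed.

Lemma schurN k rho A : schur k rho (- A) = - schur k rho A.
Proof. by rewrite -scaleN1r schurZ scaleN1r. Qed.

Lemma schur_sub k l rho A : schur k rho A - schur l rho A =
  schur (fun x y => k x y - l x y) rho A.
Proof.
rewrite /schur -sumrB; apply: eq_bigr => x _; rewrite -sumrB.
by apply: eq_bigr => y _; rewrite -scalerBl -rmorphB.
Qed.

Lemma schur_mulr k f rho A : schur k rho (A *m mxfun f rho) =
  schur (fun x y => k x y * f y) rho A.
Proof.
apply: eq_bigr => x _; apply: eq_bigr => y _.
have := mxfun_eproj f rho y; move: (mxfun f rho) => F h.
rewrite mulmxA -(mulmxA _ F) h -scalemxAr scalerA.
by rewrite (rmorphM (real_complex R)).
Qed.

Lemma schur_mull k f rho A : schur k rho (flip (mxfun f rho) *m A) =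
  schur (fun x y => k x y * f x) rho A.
Proof.
apply: eq_bigr => x _; apply: eq_bigr => y _.
have := eprojM f rho x; move: (mxfun f rho) => F h.
rewrite mulmxA -flipM h flipZ -!scalemxAl scalerA.
by rewrite (rmorphM (real_complex R)).
Qed.

Lemma schur1 rho A : schur (fun _ _ => 1) rho A = A.
Proof.
rewrite /schur; under eq_bigr => x _ do
  [under eq_bigr => y _ do rewrite rmorph1 scale1r; rewrite -mulmx_sumr].
by rewrite -!mulmx_suml -flip_sum !eproj_sum flip1 mul1mx mulmx1.
Qed.

Lemma schur_adj k rho A : (schur k rho A)^t* =
  flip (schur (fun x y => k y x) rho (flip (A^t*))).
Proof.
rewrite /schur adj_sum flip_sum.
under eq_bigr do rewrite adj_sum.
under [RHS]eq_bigr do rewrite flip_sum.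
rewrite exchange_big /=; apply: eq_bigr => x _; apply: eq_bigr => y _.
have := eproj_adj rho x; have := eproj_adj rho y.
move: (eproj rho x) (eproj rho y) => E F hF hE; rewrite adjZr flipZ.
by rewrite 2!adjM 2!flipM flip_adj hE hF 2!flipK mulmxA.
Qed.

Lemma clifford_schur k rho A : rho^t* = rho -> clifford rho -> clifford A ->
  clifford (schur k rho A).
Proof.
move=> hr cr cA; apply: clifford_sum => x _; apply: clifford_sum => y _.
apply/clifford_scale/clifford_mul; last exact: clifford_eproj.
by apply: clifford_mul => //; apply/clifford_flip/clifford_eproj.
Qed.

Lemma pdensity_spec rho : pdensity rho -> {in spec rho, forall x, 0 < x}.
Proof.
move=> /pdensityP[_ /posdef_spec[e e0 he] _] x /he; exact: lt_le_trans.
Qed.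

(** The integrand is the Schur multiplier x^(1-s) y^s, so integrating in s
    leaves the logarithmic mean. *)
Lemma sharpE rho A : pdensity rho -> sharp rho A = schur (@powmean R) rho A.
Proof.
move=> pr; have pos := pdensity_spec pr.
have /pdensityP[cr [hr _] _] := pr.
(* A single sum over pairs, on which the integral acts termwise. *)
pose s := [seq (x, y) | x <- spec rho, y <- spec rho].
pose K (p : R * R) := flip (eproj rho p.1) *m A *m eproj rho p.2.
transitivity (\sum_(p <- s) (powmean p.1 p.2)%:C *: K p); last first.
  by rewrite big_allpairs.
rewrite /sharp (_ : (fun t => _) = fun t => \sum_(p <- s)
    (p.1 `^ (1 - t) * p.2 `^ t)%:C *: K p).
  rewrite mxintegral01_sum // => p /allpairsP[[x y] [/= xs ys ->]].
  by apply: integrable_powR; apply: pos.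
apply/funext => t; rewrite Gamma_flip // /mxpowR mxfun_flip // !mxfunE.
rewrite flip_sum !mulmx_suml big_allpairs; apply: eq_bigr => x _.
rewrite mulmx_sumr; apply: eq_bigr => y _.
rewrite flipZ -scalemxAr -!scalemxAl scalerA mulrC.
by rewrite (rmorphM (real_complex R)).
Qed.

Lemma half_real : (2^-1 : C) = (2^-1 : R)%:C.
Proof. by rewrite fmorphV rmorph_nat. Qed.

(** Chain rule: log rho on the right multiplies the (x, y) block by ln y, its
    flip on the left by ln x, and the logarithmic mean satisfies
    powmean x y * (ln y - ln x) = y - x. *)
Lemma sharp_commutator_log rho B : pdensity rho ->
  sharp rho (B *m mxlog rho - flip (mxlog rho) *m B) =
  B *m rho - flip rho *m B.
Proof.
move=> pr; have pos := pdensity_spec pr.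
have /pdensityP[cr [hr _] _] := pr.
rewrite sharpE // schurB schur_mulr schur_mull schur_sub.
have -> : B *m rho - flip rho *m B =
    schur (fun _ _ => 1) rho (B *m mxfun id rho - flip (mxfun id rho) *m B).
  by rewrite schur1 mxfun_id.
rewrite [RHS]schurB schur_mulr schur_mull schur_sub.
apply: eq_schur => x y xs ys; rewrite !mul1r -mulrBr.
by rewrite powmean_log //; apply: pos.
Qed.

(** Taking adjoints exchanges the roles of x and y, and the logarithmic mean is
    symmetric. *)
Lemma sharp_adj rho A : pdensity rho ->
  (sharp rho A)^t* = flip (sharp rho (flip (A^t*))).
Proof.
move=> pr; have pos := pdensity_spec pr.
rewrite 2!(sharpE _ pr) schur_adj; apply: (congr1 (@flip R n)).
apply: eq_schur => x y xs ys.
by rewrite powmeanC //; apply: pos.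
Qed.

Lemma clifford_sharp rho A : pdensity rho -> clifford A ->
  clifford (sharp rho A).
Proof.
move=> pr cA; have /pdensityP[cr [hr _] _] := pr.
by rewrite sharpE //; apply: clifford_schur.
Qed.

Lemma nablaE A i : clifford A ->
  nabla A i = 2^-1 *: (Q i *m A - flip A *m Q i).
Proof. by move=> cA; rewrite /nabla Gamma_flip. Qed.

Lemma nabla_adjE A i : clifford A ->
  nabla_adj i A = 2^-1 *: (Q i *m A + flip A *m Q i).
Proof. by move=> cA; rewrite /nabla_adj Gamma_flip. Qed.

Lemma clifford_nabla A i : clifford A -> clifford (nabla A i).
Proof.
move=> cA; rewrite nablaE //; apply/clifford_scale/clifford_sub.
  by apply: clifford_mul; [apply: clifford_gen|].
by apply: clifford_mul; [apply: clifford_flip|apply: clifford_gen].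
Qed.

Lemma clifford_nabla_adj A i : clifford A -> clifford (nabla_adj i A).
Proof.
move=> cA; rewrite nabla_adjE //; apply/clifford_scale/clifford_add.
  by apply: clifford_mul; [apply: clifford_gen|].
by apply: clifford_mul; [apply: clifford_flip|apply: clifford_gen].
Qed.

Lemma nablaB A B i : clifford A -> clifford B ->
  nabla (A - B) i = nabla A i - nabla B i.
Proof.
move=> cA cB; have cAB := clifford_sub cA cB.
rewrite !nablaE // flipB mulmxBr mulmxBl -scalerBr; congr (_ *: _).
by rewrite !opprB addrACA [RHS]addrACA; congr (_ + _); rewrite addrC.
Qed.

Lemma nabla_adjN A i : clifford A -> nabla_adj i (- A) = - nabla_adj i A.
Proof.
move=> cA; have cN := clifford_opp cA.
by rewrite !nabla_adjE // flipN mulmxN mulNmx -opprD scalerN.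
Qed.

Lemma nabla_selfadj U i : clifford U -> U^t* = U ->
  flip ((nabla U i)^t*) = nabla U i.
Proof.
move=> cU hU; rewrite (nablaE _ cU) half_real adjZr adjB 2!adjM flip_adj hU.
rewrite Qgen_adj flipZ flipB !flipM flipQ flipK mulmxN mulNmx opprK.
by rewrite addrC.
Qed.

Lemma tauD A B : tau (A + B) = tau A + tau B.
Proof. by rewrite /tau mxtraceD mulrDr. Qed.

Lemma tauB A B : tau (A - B) = tau A - tau B.
Proof. by rewrite /tau raddfB mulrBr. Qed.

Lemma tauN A : tau (- A) = - tau A.
Proof. by rewrite /tau raddfN mulrN. Qed.

(** Integration by parts: the trace is invariant under flip, which changes the
    sign of Q_i. *)
Lemma nabla_duality A B i : clifford A -> clifford B ->
  tau ((nabla A i)^t* *m B) = tau (A^t* *m nabla_adj i B).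
Proof.
move=> cA cB; rewrite (nablaE _ cA) (nabla_adjE _ cB) half_real adjZr adjB 2!adjM.
rewrite flip_adj Qgen_adj -scalemxAl -scalemxAr !tauZ; congr (_ * _).
rewrite mulmxBl mulmxDr tauB tauD mulmxA; congr (_ + _).
rewrite -[tau (Q i *m _ *m B)]tau_flip !flipM flipQ flipK !mulNmx tauN opprK.
by rewrite -mulmxA tauC -mulmxA.
Qed.

Lemma tau_nabla_adj B i : clifford B -> tau (nabla_adj i B) = 0.
Proof.
move=> cB; rewrite nabla_adjE // tauZ tauD.
rewrite -[tau (flip B *m _)]tau_flip flipM flipK flipQ mulmxN tauN tauC.
by rewrite subrr mulr0.
Qed.

Lemma clifford_cdiv X : (forall i, clifford (X i)) -> clifford (cdiv X).
Proof.
move=> cX; apply/clifford_opp/clifford_sum => i _.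
exact: clifford_nabla_adj.
Qed.

Lemma cdivN X : (forall i, clifford (X i)) ->
  cdiv (fun i => - X i) = - cdiv X.
Proof.
move=> cX; have E : \sum_i nabla_adj i (- X i) = - \sum_i nabla_adj i (X i).
  by rewrite -sumrN; apply: eq_bigr => i _; apply: nabla_adjN.
exact: (congr1 -%R E).
Qed.

Lemma tangent_clifford X i : tangent X -> clifford (X i).
Proof. by move=> [U [cU _ ->]]; apply: clifford_nabla. Qed.

Lemma tangent_flip X i : tangent X -> flip ((X i)^t*) = X i.
Proof. by move=> [U [cU hU ->]]; apply: nabla_selfadj. Qed.

Lemma clifford_flux rho X : pdensity rho -> tangent X ->
  clifford (cdiv (vsharp rho X)).
Proof.
move=> pr tX; apply: clifford_cdiv => i; apply: clifford_sharp => //.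
exact: tangent_clifford.
Qed.

Lemma tau_flux rho X : pdensity rho -> tangent X ->
  tau (cdiv (vsharp rho X)) = 0.
Proof.
move=> pr tX; rewrite tauN tau_sum big1 ?oppr0 // => i _.
apply/tau_nabla_adj/clifford_sharp => //; exact: tangent_clifford.
Qed.

(** For a gradient field X of a self-adjoint potential, Y = rho # X_i satisfies
    Y^* = flip Y; the two terms of nabla_i^* Y are then adjoint to each
    other. *)
Lemma flux_adj rho X : pdensity rho -> tangent X ->
  (cdiv (vsharp rho X))^t* = cdiv (vsharp rho X).
Proof.
move=> pr tX; rewrite /cdiv adjN adj_sum; congr (- _).
apply: eq_bigr => i _.
have cY : clifford (vsharp rho X i).
  by apply: clifford_sharp => //; exact: tangent_clifford.
have hY : (vsharp rho X i)^t* = flip (vsharp rho X i).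
  by rewrite /vsharp (sharp_adj _ pr) (tangent_flip _ tX).
rewrite (nabla_adjE _ cY) half_real adjZr adjD 2!adjM flip_adj hY flipK Qgen_adj.
by rewrite addrC.
Qed.

Lemma metric_flux rho U X : pdensity rho -> tangent X -> clifford U ->
  metric rho (nabla U) X = tau (U^t* *m (- cdiv (vsharp rho X))).
Proof.
move=> pr tX cU; rewrite /cdiv opprK mulmx_sumr tau_sum.
apply: eq_bigr => i _; apply: nabla_duality => //.
by apply: clifford_sharp => //; exact: tangent_clifford.
Qed.

Lemma tau_pow2E A : tau A = (((2 : R) ^+ n)^-1)%:C * \tr A.
Proof. by rewrite /tau fmorphV rmorphXn rmorph_nat. Qed.

Lemma pow2V_gt0 : 0 < ((2 : R) ^+ n)^-1.
Proof. by rewrite invr_gt0 exprn_gt0. Qed.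

Lemma tr_sandwich (E F A : M) : E^t* = E -> E *m E = E -> F^t* = F ->
  F *m F = F ->
  \tr (A^t* *m (F *m A *m E)) = \tr ((F *m A *m E)^t* *m (F *m A *m E)).
Proof.
move=> hE EE hF FF; rewrite !adjM hE hF -!mulmxA (mulmxA F F) FF.
by rewrite [RHS]mxtrace_mulC -!mulmxA EE.
Qed.

Lemma flip_eproj_adj rho x : (flip (eproj rho x))^t* = flip (eproj rho x).
Proof. by rewrite flip_adj eproj_adj. Qed.

Lemma flip_eproj_idem rho x :
  flip (eproj rho x) *m flip (eproj rho x) = flip (eproj rho x).
Proof. by rewrite -flipM eproj_idem. Qed.

(** With F_x = flip E_x, tau (X^* (rho # X)) is the sum over (x, y) of
    powmean x y times the squared norm of F_x X E_y.  All terms are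
    nonnegative, so each block F_x X E_y vanishes. *)
Lemma metric_definite rho X : pdensity rho -> metric rho X X = 0 ->
  forall i, X i = 0.
Proof.
move=> pr; have pos := pdensity_spec pr.
pose w i x y := flip (eproj rho x) *m X i *m eproj rho y.
have E i : tau ((X i)^t* *m vsharp rho X i) =
    \sum_(x <- spec rho) \sum_(y <- spec rho)
      (((2 : R) ^+ n)^-1 * powmean x y)%:C * \tr ((w i x y)^t* *m w i x y).
  rewrite /vsharp sharpE // /schur mulmx_sumr tau_sum.
  apply: eq_bigr => x _; rewrite mulmx_sumr tau_sum; apply: eq_bigr => y _.
  rewrite -scalemxAr tau_pow2E mxtraceZ mulrA -(rmorphM (real_complex R)).
  congr (_ * _); apply: tr_sandwich; first exact: eproj_adj.
  - exact: eproj_idem.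
  - exact: flip_eproj_adj.
  - exact: flip_eproj_idem.
have ge0 i x y : x \in spec rho -> y \in spec rho ->
    0 <= (((2 : R) ^+ n)^-1 * powmean x y)%:C * \tr ((w i x y)^t* *m w i x y).
  move=> xs ys; rewrite mulr_ge0 ?frob_ge0 // ler0c mulr_ge0 //.
  by apply/ltW/powmean_gt0; apply: pos.
have ge1 i x : x \in spec rho -> 0 <= \sum_(y <- spec rho)
    (((2 : R) ^+ n)^-1 * powmean x y)%:C * \tr ((w i x y)^t* *m w i x y).
  by move=> xs; rewrite big_seq; apply: sumr_ge0 => y ys; apply: ge0.
rewrite /metric => /eqP; rewrite psumr_eq0 => [|i _]; last first.
  by rewrite E big_seq; apply: sumr_ge0 => x xs; apply: ge1.
move=> /allP h i; have := h i (mem_index_enum _); rewrite /= E.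
rewrite big_seq psumr_eq0 => [/allP {}h|x xs]; last exact: ge1.
rewrite -[LHS](schur1 rho) /schur big_seq big1 // => x xs.
have := h x xs; rewrite xs /= big_seq psumr_eq0 => [/allP {}h|y ys]; last first.
  exact: ge0.
rewrite big_seq big1 // => y ys; have := h y ys; rewrite ys /= mulf_eq0.
case/orP => [|/eqP/frob_eq0]; last by rewrite -/(w i x y) => ->; rewrite scaler0.
rewrite fmorph_eq0 mulf_eq0 !gt_eqF ?pow2V_gt0 //.
by apply: powmean_gt0; apply: pos.
Qed.

End FermionicCalculus.

(** * The number operator and the Mehler semigroup *)
Section MehlerSemigroup.
Set Implicit Arguments.
Unset Strict Implicit.
Unset Printing Implicit Defensive.
Local Open Scope sesquilinear_scope.
Variables (R : realType) (n : nat).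
Local Notation C := R[i].
Local Notation M := 'M[C]_(2 ^ n).
Local Notation Q := (@Qgen R n).
Implicit Types (A B : M) (i j : 'I_n) (a b : {set 'I_n}) (t e : R).

(** The automorphism Q_i |-> - Q_i that fixes the other generators: flip changes
    all the signs and conjugation by Q_i restores all of them but its own. *)
Definition reflection i A : M := locked (Q i *m flip A *m Q i).

Lemma reflectionE i A : reflection i A = Q i *m flip A *m Q i.
Proof. by rewrite /reflection -lock. Qed.

Lemma reflectionM i A B :
  reflection i (A *m B) = reflection i A *m reflection i B.
Proof.
rewrite !reflectionE flipM; move: (flip A) (flip B) => {}A {}B.
by rewrite -!mulmxA (mulmxA (Q i) (Q i)) Qgen_sqr mul1mx.
Qed.

Lemma reflectionQ i j :
  reflection i (Q j) = if i == j then - Q j else Q j.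
Proof.
rewrite reflectionE flipQ mulmxN mulNmx; case: eqVneq => [->|ij].
  by rewrite Qgen_sqr mul1mx.
by rewrite (QgenC _ ij) mulNmx opprK -mulmxA Qgen_sqr mulmx1.
Qed.

Lemma reflectionZ i z A : reflection i (z *: A) = z *: reflection i A.
Proof. by rewrite !reflectionE flipZ -scalemxAr -scalemxAl. Qed.

Lemma reflection_sum i (I : Type) (s : seq I) (F : I -> M) :
  reflection i (\sum_(k <- s) F k) = \sum_(k <- s) reflection i (F k).
Proof.
rewrite reflectionE flip_sum mulmx_sumr mulmx_suml.
by apply: eq_bigr => k _; rewrite reflectionE.
Qed.

Lemma reflection1 i : reflection i 1%:M = 1%:M.
Proof. by rewrite reflectionE flip1 mulmx1 Qgen_sqr. Qed.

Lemma reflection_Qmon i a :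
  reflection i (Qmon R a) = (-1) ^+ (i \in a) *: Qmon R a.
Proof.
have -> : (-1 : C) ^+ (i \in a) = \prod_(j in a) (if i == j then -1 else 1).
  have [ia|ia] := boolP (i \in a).
    rewrite (bigD1 i) //= eqxx big1 ?mulr1 // => j /andP[_].
    by rewrite eq_sym => /negbTE ->.
  by rewrite big1 // => j ja; case: eqP => // ij; rewrite ij ja in ia.
rewrite /Qmon.
apply: (big_rec3 (fun X (z : C) Y => reflection i X = z *: Y)).
  by rewrite scale1r reflection1.
move=> j X z Y _ IH; rewrite [LHS]reflectionM reflectionQ IH.
by case: eqP => _; rewrite ?mulN1r ?mul1r ?scaleNr ?mulNmx -scalemxAr.
Qed.

Lemma reflection_adj i A : (reflection i A)^t* = reflection i (A^t*).
Proof. by rewrite !reflectionE 2!adjM flip_adj Qgen_adj mulmxA. Qed.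

Lemma qform_reflection_ge0 i A v : (forall w, 0 <= qform A w) ->
  0 <= qform (reflection i A) v.
Proof.
move=> h; rewrite reflectionE flipE.
have -> : Q i *m (parity R n *m A *m parity R n) *m Q i =
  (Q i *m parity R n) *m A *m (Q i *m parity R n)^t*.
  by rewrite adjM parity_adj Qgen_adj !mulmxA.
by rewrite qform_conj.
Qed.

(** In nabla_i^* nabla_i A the four terms are A, A and twice - R_i A, up to the
    factor 1/4. *)
Lemma numop_reflection A : clifford A ->
  numop A = \sum_(i < n) 2^-1 *: (A - reflection i A).
Proof.
move=> cA; rewrite /numop /cdiv opprK; apply: eq_bigr => i _.
have cN := clifford_nabla i cA.
rewrite (nabla_adjE _ cN) (nablaE _ cA) flipZ flipB 2!flipM flipK flipQ.
rewrite -scalemxAr -scalemxAl -scalerDr scalerA reflectionE.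
move: (flip A) => A'.
rewrite mulmxBr (mulmxA (Q i) (Q i)) (mulmxA (Q i) A') mulNmx mulmxN opprK.
rewrite mulmxDl mulNmx -(mulmxA A) Qgen_sqr mul1mx mulmx1.
have -> : A - Q i *m A' *m Q i + (- (Q i *m A' *m Q i) + A) =
   2 *: (A - Q i *m A' *m Q i).
  by rewrite [- _ + A]addrC scaler_nat mulr2n.
by rewrite scalerA -mulrA mulVf ?mulr1 // pnatr_eq0.
Qed.

Lemma coefZ a z A : coef a (z *: A) = z * coef a A.
Proof. by rewrite /coef -scalemxAr tauZ. Qed.

Lemma coefN a A : coef a (- A) = - coef a A.
Proof. by rewrite -scaleN1r coefZ mulN1r. Qed.

Lemma numop_expand A : clifford A ->
  numop A = \sum_(a : {set 'I_n}) (#|a|%:R * coef a A) *: Qmon R a.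
Proof.
move=> cA; rewrite (numop_reflection cA).
have E i : 2^-1 *: (A - reflection i A) =
    \sum_(a : {set 'I_n}) ((i \in a)%:R * coef a A) *: Qmon R a.
  rewrite {1 2}(clifford_expand cA) reflection_sum -sumrB scaler_sumr.
  apply: eq_bigr => a _; rewrite reflectionZ reflection_Qmon.
  rewrite scalerA -scalerBl scalerA; congr (_ *: _).
  case: (i \in a); last by rewrite expr0 mulr1 subrr mulr0 mul0r.
  rewrite expr1 mulrN1 opprK -mulr2n -[coef a A *+ 2]mulr_natr mulrCA.
  by rewrite mulVf ?pnatr_eq0 // mulr1 mul1r.
under eq_bigr do rewrite E.
rewrite exchange_big /=; apply: eq_bigr => a _.
rewrite -scaler_suml -mulr_suml -natr_sum.
suff -> : (\sum_(i < n) (i \in a))%N = #|a| by [].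
by rewrite -sum1_card [RHS]big_mkcond; apply: eq_bigr => i _; case: (i \in a).
Qed.

Lemma clifford_comb (c : {set 'I_n} -> C) :
  clifford (\sum_(a : {set 'I_n}) c a *: Qmon R a).
Proof.
by apply: clifford_sum => a _; apply/clifford_scale/clifford_Qmon.
Qed.

Lemma coef_numop a A : clifford A -> coef a (numop A) = #|a|%:R * coef a A.
Proof.
move=> cA; rewrite (numop_expand cA).
exact: (coefE (fun a => #|a|%:R * coef a A)).
Qed.

Lemma clifford_numop A : clifford A -> clifford (numop A).
Proof. by move=> cA; rewrite (numop_expand cA); apply: clifford_comb. Qed.

Lemma iter_numop k A : clifford A ->
  iter k (@numop R n) A = \sum_(a : {set 'I_n}) (#|a|%:R ^+ k * coef a A) *: Qmon R a.
Proof.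
(* [numop_expand] is available on the Clifford algebra, so membership in it
   is carried along. *)
move=> cA; have [ci ->] : clifford (iter k (@numop R n) A) /\
    iter k (@numop R n) A = \sum_(a : {set 'I_n}) (#|a|%:R ^+ k * coef a A) *: Qmon R a.
  elim: k => [|k [cI IH]].
    split=> //; rewrite /= [LHS](clifford_expand cA).
    by apply: eq_bigr => a _; rewrite expr0 mul1r.
  split; first by rewrite iterS; apply: clifford_numop.
  rewrite iterS (numop_expand cI); apply: eq_bigr => a _; congr (_ *: _).
  rewrite {1}IH (coefE (fun a => #|a|%:R ^+ k * coef a A)).
  by rewrite exprS mulrA.
by [].
Qed.

Lemma mehlerE t A : clifford A ->
  mehler t A = \sum_(a : {set 'I_n}) (expR (- t * #|a|%:R))%:C *: (coef a A *: Qmon R a).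
Proof.
move=> cA; rewrite /mehler (_ : (fun k => _) =
    fun k => \sum_(a : {set 'I_n})
      (exp_coeff (- t * #|a|%:R) k)%:C *: (coef a A *: Qmon R a)).
  apply: (@mxseries_sum _ _ _ _
    (fun (a : {set 'I_n}) k => exp_coeff (- t * #|a|%:R) k)) => a.
  exact: is_cvg_series_exp_coeff.
apply/funext => k; rewrite (iter_numop _ cA) scaler_sumr.
apply: eq_bigr => a _; rewrite !scalerA; congr (_ *: _).
rewrite mulrA; congr (_ * _); rewrite /exp_coeff /=.
rewrite -(rmorph_nat (real_complex R)) -rmorphXn -(rmorphM (real_complex R)).
by congr (_%:C); rewrite exprMn mulrAC.
Qed.

Lemma mehler_comb t A : clifford A -> mehler t A =
  \sum_(a : {set 'I_n}) ((expR (- t * #|a|%:R))%:C * coef a A) *: Qmon R a.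
Proof.
by move=> cA; rewrite (mehlerE t cA); apply: eq_bigr => a _; rewrite scalerA.
Qed.

Lemma clifford_mehler t A : clifford A -> clifford (mehler t A).
Proof. by move=> cA; rewrite (mehler_comb t cA); apply: clifford_comb. Qed.

Lemma coef_mehler t a A : clifford A ->
  coef a (mehler t A) = (expR (- t * #|a|%:R))%:C * coef a A.
Proof.
move=> cA; rewrite (mehler_comb t cA).
exact: (coefE (fun a => (expR (- t * #|a|%:R))%:C * coef a A)).
Qed.

Lemma Qmon0 : Qmon R (finset.set0 : {set 'I_n}) = 1%:M.
Proof. by rewrite /Qmon finset.big_set0. Qed.

Lemma tau_coef A : tau A = coef finset.set0 A.
Proof. by rewrite /coef Qmon0 adj1 mul1mx. Qed.

Lemma tau_mehler t A : clifford A -> tau (mehler t A) = tau A.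
Proof.
move=> cA; rewrite !tau_coef (coef_mehler _ _ cA).
by rewrite finset.cards0 mulr0 expR0 rmorph1 mul1r.
Qed.

(** One factor of the semigroup, with e standing for e^{-t}: the monomial Q^a is
    multiplied by e if i belongs to a and by 1 otherwise. *)
Definition mixing e i A : M :=
  ((1 + e) / 2)%:C *: A + ((1 - e) / 2)%:C *: reflection i A.

Lemma posdef_mixing e i A : 0 < e <= 1 -> posdef A -> posdef (mixing e i A).
Proof.
move=> /andP[e0 e1] pA; apply: posdef_convex => //.
- by rewrite divr_gt0 // addr_gt0.
- by rewrite divr_ge0 // subr_ge0.
- by rewrite reflection_adj pA.1.
- move=> v; apply: qform_reflection_ge0 => w.
  have [hA [d d0 hd]] := pA.
  by apply: le_trans (hd w); rewrite mulr_ge0 ?sqnorm_ge0 // ler0c ltW.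
Qed.

Lemma mixing_comb e i (c : {set 'I_n} -> C) :
  mixing e i (\sum_(a : {set 'I_n}) c a *: Qmon R a) =
  \sum_(a : {set 'I_n}) ((if i \in a then e else 1)%:C * c a) *: Qmon R a.
Proof.
rewrite /mixing reflection_sum !scaler_sumr -big_split.
apply: eq_bigr => a _ /=; rewrite reflectionZ reflection_Qmon !scalerA -scalerDl.
congr (_ *: _); rewrite -mulrA [c a * _]mulrC mulrA -mulrDl; congr (_ * _).
case: (i \in a); rewrite ?expr0 ?expr1 ?mulr1 ?mulrN1 -?rmorphN -rmorphD /=.
  by congr (_%:C); field.
by congr (_%:C); field.
Qed.

Lemma mehler_mixing t A : clifford A ->
  mehler t A = foldr (mixing (expR (- t))) A (enum 'I_n).
Proof.
move=> cA; rewrite (mehler_comb t cA) [in RHS](clifford_expand cA).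
have E (s : seq 'I_n) : foldr (mixing (expR (- t)))
      (\sum_(a : {set 'I_n}) coef a A *: Qmon R a) s =
    \sum_(a : {set 'I_n}) ((\prod_(i <- s) (if i \in a then expR (- t) else 1))%:C *
             coef a A) *: Qmon R a.
  elim: s => [|i s IH] /=.
    by apply: eq_bigr => a _; rewrite big_nil rmorph1 mul1r.
  rewrite IH mixing_comb; apply: eq_bigr => a _.
  by rewrite big_cons mulrA -(rmorphM (real_complex R)).
rewrite E; apply: eq_bigr => a _; congr ((_%:C * _) *: _).
rewrite big_enum /= -big_mkcond prodr_const mulrC.
by rewrite -expRM_natl.
Qed.

Lemma posdef_mehler t A : 0 <= t -> clifford A -> posdef A ->
  posdef (mehler t A).
Proof.
move=> t0 cA pA; rewrite (mehler_mixing t cA).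
elim: (enum 'I_n) => [//|i s IH] /=; apply: posdef_mixing => //.
by rewrite expR_gt0 -[leRHS]expR0 ler_expR oppr_le0.
Qed.

Lemma pdensity_mehler t (rho : M) : 0 <= t -> pdensity rho ->
  pdensity (mehler t rho).
Proof.
move=> t0 /pdensityP[c p tr]; apply/pdensityP; split.
- exact: clifford_mehler.
- exact: posdef_mehler.
- by rewrite tau_mehler.
Qed.

Lemma numop_mehler t A : clifford A -> numop (mehler t A) =
  \sum_(a : {set 'I_n}) (#|a|%:R * expR (- t * #|a|%:R))%:C *: (coef a A *: Qmon R a).
Proof.
move=> cA; rewrite (numop_expand (clifford_mehler t cA)).
apply: eq_bigr => a _; rewrite (coef_mehler _ _ cA) scalerA; congr (_ *: _).
by rewrite mulrA -(rmorph_nat (real_complex R)) -(rmorphM (real_complex R)).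
Qed.

End MehlerSemigroup.

(** * The gradient of the entropy *)
Section EntropyGradient.
Set Implicit Arguments.
Unset Strict Implicit.
Unset Printing Implicit Defensive.
Import numFieldNormedType.Exports.
Local Open Scope classical_set_scope.
Local Open Scope sesquilinear_scope.
Variables (R : realType) (n : nat).
Local Notation C := R[i].
Local Notation M := 'M[C]_(2 ^ n).
Implicit Types (A B U rho : M) (t e : R) (X : 'I_n -> M).

(** The difference r is the relative entropy of B with respect to rho;
    the terms tr B and tr rho of Klein's inequality cancel since both densities
    have trace one. *)
Lemma entropy_bounds rho B (e : R) : 0 < e -> pdensity rho -> pdensity B ->
  {in spec rho, forall x, e <= x} ->
  let r := entropy B - complex.Re (tau (mxlog rho *m B)) in
  0 <= r /\
  r <= ((2 : R) ^+ n)^-1 / e * complex.Re (\tr ((B - rho)^t* *m (B - rho))).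
Proof.
move=> e0 pr pB he r.
have /pdensityP[_ [hr _] tr] := pr; have /pdensityP[_ [hB _] tB] := pB.
have k0 := pow2V_gt0 R n.
have [] := klein e0 hr hB he (pdensity_spec pB).
have -> : \tr B = \tr rho.
  move: tB; rewrite -tr !tau_pow2E; apply: mulfI.
  by rewrite fmorph_eq0 gt_eqF.
rewrite subrK !lecE ReB ReZ => /andP[_ h1] /andP[_ h2].
have -> : r = ((2 : R) ^+ n)^-1 * (complex.Re (\tr (B *m mxlog B)) -
    complex.Re (\tr (B *m mxlog rho))).
  have Etr A : complex.Re (tau A) = ((2 : R) ^+ n)^-1 * complex.Re (\tr A).
    by rewrite tau_pow2E ReZ.
  have scale_sub (k a a' b b' : R) : a = k * a' -> b = k * b' ->
      a - b = k * (a' - b') by move=> -> ->; rewrite mulrBr.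
  apply: scale_sub; first exact: Etr.
  by rewrite tauC; apply: Etr.
split; first by apply: mulr_ge0 => //; exact: ltW.
by rewrite -mulrA ler_pM2l.
Qed.

Lemma smooth_mxderive e (c : R -> M) : 0 < e -> mxsmooth_on e c ->
  forall i j,
    is_derive (0 : R) 1 (fun s => complex.Re (c s i j))
      (complex.Re (mxderive c 0 i j)) /\
    is_derive (0 : R) 1 (fun s => complex.Im (c s i j))
      (complex.Im (mxderive c 0 i j)).
Proof.
move=> e0 sc i j; have [sR sI] := sc i j.
have z : `|0 : R| < e by rewrite normr0.
rewrite mxE /= !derive1E; split; apply: derivableP.
- exact: (sR 0%N 0 z).
- exact: (sI 0%N 0 z).
Qed.

(** S(c(t)) is the real part of tau (log rho c(t)), which is linear in c(t), plus
    a relative entropy with derivative 0 at t = 0. *)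
Lemma entropy_derive rho e (c : R -> M) : 0 < e ->
  (forall t, `|t| < e -> pdensity (c t)) -> mxsmooth_on e c -> c 0 = rho ->
  is_derive (0 : R) 1 (fun t => entropy (c t))
    (complex.Re (tau (mxlog rho *m mxderive c 0))).
Proof.
move=> e0 pc sc c0; have dc := smooth_mxderive e0 sc.
have pr : pdensity rho by rewrite -c0; apply: pc; rewrite normr0.
have /pdensityP[_ /posdef_spec[d d0 hd] _] := pr.
pose r t := entropy (c t) - complex.Re (tau (mxlog rho *m c t)).
have dr : is_derive (0 : R) 1 r 0.
  apply: (@squeeze_derive _ r _ (((2 : R) ^+ n)^-1 / d)) (frob_derive dc) _.
    by rewrite subrr mulmx0 raddf0.
  have : \forall t \near (0 : R), `|t| < e.
    by have := nbhsx_ballx (0 : R) e e0; apply: filterS => t;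
       rewrite /ball /= sub0r normrN.
  apply: filterS => t te; rewrite c0.
  by have [h1 h2] := entropy_bounds d0 pr (pc t te) hd; apply/andP.
have dl : is_derive (0 : R) 1 (fun t => complex.Re (tau (mxlog rho *m c t)))
    (complex.Re (tau (mxlog rho *m mxderive c 0))).
  have E A : complex.Re (tau (mxlog rho *m A)) =
      complex.Re (\tr ((((2 : R) ^+ n)^-1)%:C *: mxlog rho *m A)).
    by rewrite tau_pow2E -scalemxAl mxtraceZ.
  rewrite E (_ : (fun t => _) = (fun t => complex.Re
      (\tr ((((2 : R) ^+ n)^-1)%:C *: mxlog rho *m c t)))); last first.
    by apply/funext => t; rewrite E.
  apply/is_derive_quotient; apply: quotient_Re_tr => i j.
  by have [h1 h2] := dc i j; split; apply/is_derive_quotient.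
rewrite -[X in is_derive _ _ _ X]add0r.
rewrite (_ : (fun t => _) = r + (fun t => complex.Re (tau (mxlog rho *m c t)))).
  exact: is_deriveD.
by apply/funext => t /=; rewrite /r fctE subrK.
Qed.

(** By [entropy_derive] and [metric_flux] both sides are tau (log rho H) with
    H = - div (rho # X); this number is real, being the trace of a product of two
    self-adjoint matrices. *)
Lemma entropy_gradient rho : pdensity rho ->
  is_gradient (@entropy R n) rho (nabla (mxlog rho)).
Proof.
move=> pr; have /pdensityP[cr [hr _] _] := pr.
have cl : clifford (mxlog rho) by exact: clifford_mxfun.
have hl : (mxlog rho)^t* = mxlog rho by exact: mxfun_adj.
split; first by exists (mxlog rho).
move=> e c e0 pc sc c0 X tX /eqP; rewrite addr_eq0 => /eqP dc.
have [d1 d2] := entropy_derive e0 pc sc c0.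
split; first exact: d1.
rewrite derive1E d2 (metric_flux pr tX cl) hl dc.
have := flux_adj pr tX.
move: (cdiv _) (mxlog rho) hl => H L hL hH.
apply: RRe_real; apply/CrealP.
rewrite tau_pow2E rmorphM /= conjC_real; congr (_ * _).
have -> : Num.conj (\tr (L *m - H)) = \tr ((L *m - H)^t*).
  by rewrite /mxtrace rmorph_sum; apply: eq_bigr => i _; rewrite !mxE.
by rewrite adjM adjN hL hH mxtrace_mulC.
Qed.

(** Test the difference Z of two gradients against the affine curve with
    velocity - div (rho # Z): this gives g_rho (Z, Z) = 0. *)
Lemma gradient_unique (F : M -> R) rho X Y : pdensity rho ->
  is_gradient F rho X -> is_gradient F rho Y -> X = Y.
Proof.
move=> pr [tX gX] [tY gY].
pose Z i := X i - Y i.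
have tZ : tangent Z.
  have [U [cU hU EX]] := tX; have [W [cW hW EY]] := tY.
  exists (U - W); split; first exact: clifford_sub.
    by rewrite adjB hU hW.
  by apply/funext => i; rewrite nablaB // /Z EX EY.
have /pdensityP[cr pd t1] := pr.
pose H := - cdiv (vsharp rho Z).
have hH : H^t* = H by rewrite /H adjN (flux_adj pr tZ).
have cH : clifford H by apply/clifford_opp/clifford_flux.
have tH : tau H = 0 by rewrite /H tauN (tau_flux pr tZ) oppr0.
have [e e0 he] := posdef_perturb pd hH.
pose c t := rho + t%:C *: H.
have pc t : `|t| < e -> pdensity (c t).
  move=> te; apply/pdensityP; split.
  - exact/clifford_add/clifford_scale.
  - exact: he.
  - by rewrite tauD tauZ tH mulr0 addr0.
have cRe i j : (fun t => complex.Re (c t i j)) =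
    (fun t => complex.Re (rho i j) + t * complex.Re (H i j)).
  by apply/funext => t; rewrite /c !mxE ReD ReZ.
have cIm i j : (fun t => complex.Im (c t i j)) =
    (fun t => complex.Im (rho i j) + t * complex.Im (H i j)).
  by apply/funext => t; rewrite /c !mxE ImD ImZ.
have sc : mxsmooth_on e c.
  by move=> i j; rewrite cRe cIm; split; apply: affine_smooth.
have c0 : c 0 = rho by rewrite /c scale0r addr0.
have dc : mxderive c 0 + cdiv (vsharp rho Z) = 0.
  rewrite (_ : mxderive c 0 = H); first by rewrite /H addNr.
  apply/matrixP => i j; rewrite mxE cRe cIm !affine_derive1.
  by case: (H i j).
have [_ eX] := gX e c e0 pc sc c0 Z tZ dc.
have [_ eY] := gY e c e0 pc sc c0 Z tZ dc.
have mZ : metric rho Z Z = 0.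
  have -> : metric rho Z Z = metric rho X Z - metric rho Y Z.
    rewrite /metric -sumrB; apply: eq_bigr => i _.
    by rewrite {1}/Z adjB mulmxBl tauB.
  by rewrite -eX -eY subrr.
apply/funext => i; apply/eqP; rewrite -subr_eq0.
by apply/eqP; apply: (metric_definite pr mZ i).
Qed.

Lemma entropy_flux rho : pdensity rho ->
  cdiv (vsharp rho (fun i => - nabla (mxlog rho) i)) = numop rho.
Proof.
move=> pr; have /pdensityP[cr [hr _] _] := pr.
have cl : clifford (mxlog rho) by exact: clifford_mxfun.
have E i : vsharp rho (fun i => - nabla (mxlog rho) i) i = - nabla rho i.
  rewrite /vsharp (sharpE _ pr) schurN; congr (- _).
  rewrite (nablaE _ cl) (nablaE _ cr) schurZ -(sharpE _ pr).
  by rewrite (sharp_commutator_log _ pr).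
have -> : vsharp rho (fun i => - nabla (mxlog rho) i) = fun i => - nabla rho i.
  by apply/funext => i; apply: E.
by apply: cdivN => i; apply: clifford_nabla.
Qed.

End EntropyGradient.

(** * Solving the flow equation *)
Section GradientFlow.
Set Implicit Arguments.
Unset Strict Implicit.
Unset Printing Implicit Defensive.
Import numFieldNormedType.Exports.
Local Open Scope classical_set_scope.
Local Open Scope sesquilinear_scope.
Variables (R : realType) (n : nat).
Local Notation C := R[i].
Local Notation M := 'M[C]_(2 ^ n).
Implicit Types (rho D : R -> M).

Lemma Re_ext (z w : C) : complex.Re z = complex.Re w ->
  complex.Re (- 'i * z) = complex.Re (- 'i * w) -> z = w.
Proof.
case: z w => a b [c d] /= ->.
by rewrite !(oppr0, mul0r, mulN1r, opprK, sub0r) => ->.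
Qed.

(** The complex parameter z gives access to both parts of the coefficient:
    z = 1 is its real part and z = - i its imaginary part. *)
Lemma coef_flow rho D a (z : C) :
  (forall t, 0 <= t -> clifford (rho t)) ->
  (forall t, 0 <= t -> mxis_halfline_derive rho t (D t)) ->
  (forall t, 0 <= t -> D t = - numop (rho t)) ->
  forall t, 0 <= t -> complex.Re (z * coef a (rho t)) =
    expR (- t * #|a|%:R) * complex.Re (z * coef a (rho 0)).
Proof.
move=> cr dr Dr t t0.
have E A : complex.Re (z * coef a A) =
    complex.Re (\tr ((z * (((2 : R) ^+ n)^-1)%:C) *: (Qmon R a)^t* *m A)).
  by rewrite /coef tau_pow2E mulrA -scalemxAl mxtraceZ.
have -> : - t * #|a|%:R = - #|a|%:R * t by rewrite !mulNr mulrC.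
apply: (@halfline_exp_unique _ _
  (fun t => complex.Re (z * coef a (rho t)))) => // s s0.
rewrite /is_halfline_derive.
have -> : - #|a|%:R * complex.Re (z * coef a (rho s)) =
    complex.Re (z * coef a (D s)).
  rewrite (Dr s s0) coefN (coef_numop _ (cr s s0)) -[LHS]ReZ.
  rewrite rmorphN rmorph_nat; move: (coef a _) => w.
  by rewrite mulNr mulrN mulrCA.
rewrite (E (D s)).
rewrite (_ : (fun u => _) = fun u =>
  (complex.Re (\tr ((z * (((2 : R) ^+ n)^-1)%:C) *: (Qmon R a)^t* *m rho u)) -
   complex.Re (\tr ((z * (((2 : R) ^+ n)^-1)%:C) *: (Qmon R a)^t* *m rho s)))
   / (u - s)); last by apply/funext => u; rewrite (E (rho u)) (E (rho s)).
apply: quotient_Re_tr => i j; exact: dr.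
Qed.

Lemma gradient_flow_mehler rho D :
  (forall t, 0 <= t -> clifford (rho t)) ->
  (forall t, 0 <= t -> mxis_halfline_derive rho t (D t)) ->
  (forall t, 0 <= t -> D t = - numop (rho t)) ->
  forall t, 0 <= t -> rho t = mehler t (rho 0).
Proof.
move=> cr dr Dr t t0; rewrite (mehler_comb t (cr 0 (lexx _))).
rewrite {1}(clifford_expand (cr t t0)); apply: eq_bigr => a _.
congr (_ *: _); have h z := coef_flow a z cr dr Dr t0.
apply: Re_ext; first by have := h 1; rewrite !mul1r => ->; rewrite ReZ.
by rewrite h -ReZ mulrCA.
Qed.

(** The semigroup commutes with its generator, so the derivative of a Mehler
    orbit is again a Mehler orbit, in particular continuous. *)
Lemma mehler_numop t (A : M) : clifford A ->
  mehler t (- numop A) = - numop (mehler t A).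
Proof.
move=> cA; have cN := clifford_opp (clifford_numop cA).
rewrite (mehlerE t cN) (numop_mehler t cA) -sumrN; apply: eq_bigr => a _.
rewrite coefN (coef_numop _ cA) !scalerA -[RHS]scaleNr; congr (_ *: _).
rewrite mulrN mulrA; congr (- (_ * _)).
by rewrite -(rmorph_nat (real_complex R)) -(rmorphM (real_complex R)) mulrC.
Qed.

Lemma mehler_derive (t : R) (A : M) i j : clifford A ->
  is_derive t 1 (fun s => complex.Re (mehler s A i j))
    (complex.Re (mehler t (- numop A) i j)) /\
  is_derive t 1 (fun s => complex.Im (mehler s A i j))
    (complex.Im (mehler t (- numop A) i j)).
Proof.
move=> cA.
have -> : mehler t (- numop A) = \sum_(a : {set 'I_n})
    (- (#|a|%:R * expR (- t * #|a|%:R)))%:C *: (coef a A *: Qmon R a).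
  rewrite (mehler_numop t cA) (numop_mehler t cA) -sumrN.
  by apply: eq_bigr => a _; rewrite rmorphN scaleNr.
have dexp (a : {set 'I_n}) : is_derive t 1
    (fun s => expR (- s * #|a|%:R)) (- (#|a|%:R * expR (- t * #|a|%:R))).
  have d1 : is_derive t 1 (fun s : R => - s * #|a|%:R) (- #|a|%:R).
    by apply: is_derive_eq; rewrite /GRing.scale /=; ring.
  have := @is_derive1_comp _ expR (fun s : R => - s * #|a|%:R) t _ _
    (is_derive_expR _) d1.
  by rewrite mulrN mulrC.
rewrite Re_entry Im_entry; split.
  rewrite (_ : (fun s => _) = fun s => \sum_(a : {set 'I_n})
      expR (- s * #|a|%:R) * complex.Re ((coef a A *: Qmon R a) i j)).
    exact: is_derive_comb.
  by apply/funext => s; rewrite (mehlerE s cA) Re_entry.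
rewrite (_ : (fun s => _) = fun s => \sum_(a : {set 'I_n})
    expR (- s * #|a|%:R) * complex.Im ((coef a A *: Qmon R a) i j)).
  exact: is_derive_comb.
by apply/funext => s; rewrite (mehlerE s cA) Im_entry.
Qed.

Lemma mehler_C1 (A : M) rho : clifford A ->
  (forall t, 0 <= t -> rho t = mehler t A) ->
  C1_halfline rho (fun t => - numop (mehler t A)).
Proof.
move=> cA rhoE.
rewrite (_ : (fun t => _) = fun t => mehler t (- numop A)); last first.
  by apply/funext => t; rewrite mehler_numop.
have cN := clifford_opp (clifford_numop cA).
have cont (f : R -> R) : (forall t : R, derivable f t 1) ->
    {within `[0, +oo[, continuous f}.
  move=> h; apply: continuous_subspaceT => t.
  by apply/differentiable_continuous/derivable1_diffP/h.
split=> [t t0 i j|i j].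
  have [dR dI] := mehler_derive t i j cA.
  by split; [apply: halfline_derive dR _ t0|apply: halfline_derive dI _ t0];
     move=> s s0; rewrite (rhoE s s0).
by split; apply: cont => t; have [[dR _] [dI _]] := mehler_derive t i j cN.
Qed.

End GradientFlow.

Theorem theorem3p20 (R : realType) (n : nat) (hn : (0 < n)%N)
    (rho : R -> 'M[R[i]]_(2 ^ n)) :
  entropy_gradient_flow rho <->
  exists2 rho0 : 'M[R[i]]_(2 ^ n), pdensity rho0 &
    forall t : R, 0 <= t -> rho t = mehler t rho0.
Proof.
split=> [[pr [D [dr _] gr]]|[rho0 p0 rhoE]].
  exists (rho 0); first exact: pr.
  apply: (@gradient_flow_mehler _ _ rho D) => // [t t0|t t0].
    by have /pdensityP[] := pr t t0.
  have [G gG] := gr t t0.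
  rewrite (gradient_unique (pr t t0) gG (entropy_gradient (pr t t0))).
  by rewrite (entropy_flux (pr t t0)) => /eqP; rewrite addr_eq0 => /eqP.
have /pdensityP[c0 _ _] := p0.
have pr t : 0 <= t -> pdensity (rho t).
  by move=> t0; rewrite (rhoE t t0); apply: pdensity_mehler.
split=> //; exists (fun t => - numop (mehler t rho0)).
  exact: mehler_C1.
move=> t t0; exists (nabla (mxlog (rho t))).
  exact: entropy_gradient (pr t t0).
by rewrite (entropy_flux (pr t t0)) (rhoE t t0) addNr.
Qed.
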